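(* Let $\mathcal{F}$ and $\mathcal{G}$ be convex with $\mathcal{G}\subseteq\mathcal{F}$, let $\delta>0$, and suppose that $f^*_\delta\in\mathcal{F}$ and $g^*_\delta\in\mathcal{G}$ achieve the ordered modulus $\omega(\delta;\mathcal{F},\mathcal{G})$ with $\|K(f^*_\delta-g^*_\delta)\|=\delta$. Let $$\hat c_{\alpha,\delta,\mathcal{F},\mathcal{G}}=\hat L_{\delta,\mathcal{F},\mathcal{G}}-\overline{\mathrm{bias}}_{\mathcal{F}}(\hat L_{\delta,\mathcal{F},\mathcal{G}})-z_{1-\alpha}\,\sigma\,\omega'(\delta;\mathcal{F},\mathcal{G}).$$ Then, for $\beta=\Phi(\delta/\sigma-z_{1-\alpha})$, $\hat c_{\alpha,\delta,\mathcal{F},\mathcal{G}}$ minimizes $q_\beta(\hat c,\mathcal{G})=\sup_{g\in\mathcal{G}}q_{g,\beta}(Lg-\hat c)$ among all one-sided $1-\alpha$ confidence intervals $[\hat c,\infty)$. The minimum coverage of $[\hat c_{\alpha,\delta,\mathcal{F},\mathcal{G}},\infty)$ over $\mathcal{F}$ is taken at $f^*_\delta$ and equals $1-\alpha$. All quantiles of the excess length $Lg-\hat c_{\alpha,\delta,\mathcal{F},\mathcal{G}}$, $g\in\mathcal{G}$, are maximized at $g=g^*_\delta$. The worst-case $\beta$th quantile of excess length is $q_\beta(\hat c_{\alpha,\delta,\mathcal{F},\mathcal{G}},\mathcal{G})=\omega(\delta;\mathcal{F},\mathcal{G})$.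
   Context: Model: one observes $Y=Kf+\sigma\varepsilon$, where $f$ is known to lie in a convex subset $\mathcal{F}$ of a vector space, $K$ is a known linear operator from (the span of) $\mathcal{F}$ to a real Hilbert space $\mathcal{Y}$ with inner product $\langle\cdot,\cdot\rangle$ and norm $\|\cdot\|$, $\sigma>0$ is known, and $\varepsilon$ is standard Gaussian: for each $g\in\mathcal{Y}$, $\langle\varepsilon,g\rangle\sim\mathcal{N}(0,\|g\|^2)$. $L$ is a linear functional; the parameter of interest is $Lf$. $P_f,E_f$ denote probability and expectation under $f$; $\alpha\in(0,1)$; $\Phi$ is the standard normal cdf and $z_q$ its $q$-quantile. A one-sided $1-\alpha$ confidence interval is $[\hat c,\infty)$ with $\hat c=\hat c(Y)$ and $\inf_{f\in\mathcal{F}}P_f(Lf\in[\hat c,\infty))\ge 1-\alpha$. $q_{f,\beta}(\cdot)$ denotes the $\beta$th quantile under $P_f$. For an estimator $\hat L$, $\overline{\mathrm{bias}}_{\mathcal{F}}(\hat L)=\sup_{f\in\mathcal{F}}E_f(\hat L-Lf)$. Ordered modulus of continuity: $\omega(\delta;\mathcal{F},\mathcal{G})=\sup\{Lg-Lf:\|K(g-f)\|\le\delta,\ f\in\mathcal{F},\ g\in\mathcal{G}\}$. It is concave in $\delta$, and $\omega'(\delta;\mathcal{F},\mathcal{G})$ denotes an arbitrary (but the same throughout) element of its superdifferential $\{d:\omega(\eta;\mathcal{F},\mathcal{G})\le\omega(\delta;\mathcal{F},\mathcal{G})+d(\eta-\delta)\text{ for all }\eta>0\}$. With $f^*_{M,\delta}=(f^*_\delta+g^*_\delta)/2$,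 $$\hat L_{\delta,\mathcal{F},\mathcal{G}}=Lf^*_{M,\delta}+\frac{\omega'(\delta;\mathcal{F},\mathcal{G})}{\delta}\langle K(g^*_\delta-f^*_\delta),\,Y-Kf^*_{M,\delta}\rangle.$$
   Formalization: The clause that the minimum coverage equals 1−α is stated only when the chosen superdifferential element ω′(δ;F,G) is positive; if ω′=0, the bound ĉ is the constant Lf* and its coverage at f* is 1, so the clause fails (e.g. F=G=[0,1], K=L=id, δ=1). *)

(* Defs.v *)
From HB Require Import structures.
From mathcomp Require Import all_boot all_order all_algebra.
From mathcomp Require Import all_classical all_reals all_analysis.
From mathcomp Require Import measurable_realfun.
Set Implicit Arguments.
Unset Strict Implicit.
Unset Printing Implicit Defensive.
Import Order.TTheory GRing.Theory Num.Theory.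
Import numFieldNormedType.Exports.
Local Open Scope classical_set_scope.
Local Open Scope ring_scope.

(* N(m, s^2), for a standard deviation s >= 0.  The point mass is needed because
   normal_prob m 0 is a placeholder (uniform on [0, 1]) in the library. *)
Definition gaussian {R : realType} (m s : R) (A : set R) : \bar R :=
  if s == 0 then \d_m A else normal_prob m s A.

Definition stdnormal_cdf {R : realType} (x : R) : R :=
  fine (normal_prob 0 1 `]-oo, x]).

(* Lower quantile; the infimum is that of a nonempty set bounded below as soon
   as X is measurable and 0 < p < 1. *)
Definition quantile {R : realType} {d} {S : measurableType d}
    (mu : probability S R) (X : S -> R) (p : R) : R :=
  inf [set x : R | (p%:E <= mu [set s | (X s <= x)%R])%E].

Definition stdnormal_quantile {R : realType} (q : R) : R :=
  quantile (normal_prob (0 : R) 1) idfun q.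

Section observation.
Context {R : realType} {Y : completeNormedModType R}.

Definition is_hilbert_product (ip : {dot Y for (@idfun R)}) : Prop :=
  forall y : Y, ip y y = `|y| ^+ 2.

(* The noise and the data need not take values in Y when Y has infinite
   dimension: both are represented by their pairings <., h> with the elements h
   of Y.  A realization of the data is thus a function Y -> R, and the
   sigma-algebra is the one generated by these pairings. *)
Definition cylinder : set (set (Y -> R)) :=
  [set A | exists (h : Y) (B : set R),
     measurable B /\ A = [set y | B (y h)]].

Definition sample_space : Type := g_sigma_algebraType cylinder.

Context {d} {T : measurableType d} {P : probability T R}.

(* eps h stands for <eps, h>.  Since h |-> <eps, h> is linear, all the finite
   families of the eps h are jointly Gaussian. *)
Definition standard_gaussian_noise (eps : Y -> {RV P >-> R}) : Prop :=
  (forall (a : R) (g h : Y),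
     {ae P, forall w, eps (a *: g + h) w = a * eps g w + eps h w}) /\
  (forall (h : Y) (A : set R), measurable A ->
     distribution P (eps h) A = gaussian 0 `|h| A).

Context {V : lmodType R}.
Variables (ip : {dot Y for (@idfun R)}) (K : {linear V -> Y}) (sigma : R).
Variable eps : Y -> {RV P >-> R}.

Definition data (f : V) (w : T) : sample_space :=
  fun h => ip (K f) h + sigma * eps h w.

Lemma measurable_data (f : V) : measurable_fun setT (data f).
Proof.
apply: (@measurability _ _ T sample_space setT (data f) cylinder erefl).
move=> _ [_ [h [B [mB ->]]] <-].
have mh : measurable_fun setT (fun w => ip (K f) h + sigma * eps h w).
  by apply: measurable_funD => //; exact: measurable_funM.
exact: (mh measurableT B mB).
Qed.

HB.instance Definition _ (f : V) :=
  isMeasurableFun.Build _ _ _ _ (data f) (measurable_data f).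

Definition data_law (f : V) : probability sample_space R :=
  distribution P (data f).

End observation.
Arguments sample_space {R} Y.

Section inference.
Context {R : realType} {V : lmodType R} {d} {S : measurableType d}.
Variables (Pf : V -> probability S R) (L : V -> R).

Definition max_bias (F : set V) (Lhat : S -> R) : \bar R :=
  ereal_sup [set ('E_(Pf f)[(fun y => Lhat y - L f)%R])%E | f in F].

Definition coverage (chat : S -> R) (f : V) : \bar R :=
  Pf f [set y | chat y <= L f].

Definition one_sided_CI (F : set V) (alpha : R) (chat : S -> R) : Prop :=
  measurable_fun setT chat /\
  ((1 - alpha)%:E <= ereal_inf [set coverage chat f | f in F])%E.

Definition excess_quantile (chat : S -> R) (p : R) (g : V) : R :=
  quantile (Pf g) (fun y => L g - chat y) p.

Definition worst_excess_quantile (G : set V) (beta : R) (chat : S -> R)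
    : \bar R :=
  ereal_sup [set (excess_quantile chat beta g)%:E | g in G].

End inference.

Section modulus.
Context {R : realType} {V : lmodType R} {Y : completeNormedModType R}.
Variables (K : {linear V -> Y}) (L : {scalar V}).

Definition modulus (F G : set V) (delta : R) : \bar R :=
  ereal_sup [set x | exists f g, [/\ F f, G g, `|K (g - f)| <= delta
                                  & x = (L g - L f)%:E]].

Definition superdifferential (F G : set V) (delta : R) : set R :=
  [set d | forall eta, 0 < eta ->
     (modulus F G eta <= modulus F G delta + (d * (eta - delta))%:E)%E].

Variable ip : {dot Y for (@idfun R)}.

Definition midpoint (f g : V) : V := 2^-1 *: (f + g).

(* domega is the chosen element of the superdifferential at delta, and
   y h - ip h (K fM) is the pairing <h, Y - K fM>. *)
Definition Lhat (delta domega : R) (fs gs : V) (y : sample_space Y) : R :=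
  let fM := midpoint fs gs in
  let h := K (gs - fs) in
  L fM + domega / delta * (y h - ip h (K fM)).

(* fine is harmless here: the theorem asserts that the maximal bias is finite.
   When domega = 0 (F = G = [0, 1] in R, K and L the identity, delta = 1), chat
   is the constant L fs and its coverage is 1 everywhere, hence the proviso
   0 < domega on the exact value of the coverage. *)
Definition chat (Pf : V -> probability (sample_space Y) R) (F : set V)
    (alpha sigma delta domega : R) (fs gs : V) (y : sample_space Y) : R :=
  Lhat delta domega fs gs y
  - fine (max_bias Pf L F (Lhat delta domega fs gs))
  - stdnormal_quantile (1 - alpha) * sigma * domega.

End modulus.

(* Main.v *)
(* Along the segments from fs and gs, the superdifferential inequality of the
   modulus makes fs the least favourable element of F for the bias of Lhat, and gs
   the least favourable element of G for the excess length. Since Lhat is an affine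
   function of one Gaussian variable, this gives all the assertions on cs.
   For the optimality, if another interval had a shorter excess quantile at gs, the
   event that its length at gs is that short would be a test of level alpha of some
   f on the segment, close to fs, against gs; it would be more powerful than the
   Neyman-Pearson test of the pair (f, gs), whose power is less than beta as
   |K (gs - f)| < delta.
   The noise is only known through its one-dimensional marginals. It is split along
   K (gs - f) into a standard normal variable and an independent remainder
   (Cramer-Wold, by trigonometric test functions), and the Neyman-Pearson lemma is
   applied conditionally on the remainder, with a fixed Lagrange multiplier. *)
Require Import Defs.
From HB Require Import structures.
From mathcomp Require Import all_boot all_order all_algebra.
From mathcomp Require Import all_classical all_reals all_analysis.
From mathcomp Require Import measurable_realfun ring lra.
Set Implicit Arguments.
Unset Strict Implicit.
Unset Printing Implicit Defensive.
Import Order.TTheory GRing.Theory Num.Theory.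
Import numFieldNormedType.Exports.
Local Open Scope classical_set_scope.
Local Open Scope ring_scope.

(** In infinite dimension there is no density of the data to form a likelihood ratio from; one is
    available only along the direction that separates the two hypotheses. The independence of the
    remainder is nowhere assumed: it follows from the one-dimensional marginals, because a finite
    combination of pairings is itself, almost surely, a single pairing. Cosines with a phase suit
    this situation: their integral under one marginal is explicit, and their products are again sums
    of cosines. Indicators are then reached from them by polynomials and bounded pointwise
    limits. *)

Lemma measurable_fun_cos {R : realType} d (S : measurableType d) (f : S -> R) :
  measurable_fun setT f -> measurable_fun setT (fun x => cos (f x)).
Proof.
apply: (@measurableT_comp _ _ _ _ _ _ (@cos R)).
by apply: continuous_measurable_fun; exact: continuous_cos.
Qed.

Lemma measurable_fun_sin {R : realType} d (S : measurableType d) (f : S -> R) :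
  measurable_fun setT f -> measurable_fun setT (fun x => sin (f x)).
Proof.
apply: (@measurableT_comp _ _ _ _ _ _ (@sin R)).
by apply: continuous_measurable_fun; exact: continuous_sin.
Qed.

(** * Trigonometric test functions determine the law of a process *)

Lemma bernoulli_onem {R : realDomainType} (t : R) n : 0 <= t <= 1 ->
  1 - n%:R * t <= (1 - t) ^+ n.
Proof.
move=> /andP[t0 t1]; elim: n => [|n ih]; first by rewrite mul0r subr0 expr0.
rewrite exprS (@le_trans _ _ ((1 - t) * (1 - n%:R * t))) ?ler_wpM2l ?subr_ge0//.
rewrite -[n.+1]addn1 natrD -subr_ge0.
by rewrite (_ : _ - _ = n%:R * (t * t)); [rewrite !mulr_ge0|ring].
Qed.

Section threshold.
Context {R : realType}.

(* The polynomials of the Brosowski-Deutsch proof of the Stone-Weierstrass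
   theorem: on [0, 1] they converge to the indicator of [0, 1/2[, up to the
   value at 1/2. *)
Definition threshold (n : nat) (x : R) : R := (1 - x ^+ n) ^+ (2 ^ n).

Lemma threshold_itv n x : 0 <= x <= 1 -> 0 <= threshold n x <= 1.
Proof.
move=> /andP[x0 x1]; have h : 0 <= 1 - x ^+ n <= 1.
  by rewrite subr_ge0 exprn_ile1// gerBl exprn_ge0.
by case/andP: h => h0 h1; rewrite exprn_ge0//= exprn_ile1.
Qed.

(** Bernoulli's inequality bounds [threshold n x] from below by [1 - (2 * x) ^+ n]. *)
Lemma cvg_threshold1 x : 0 <= x < 2^-1 -> threshold n x @[n --> \oo] --> (1 : R).
Proof.
move=> /andP[x0 x1].
have c : 1 - (2 * x) ^+ n @[n --> \oo] --> (1 : R).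
  rewrite -[X in _ --> X]subr0; apply: cvgB; first exact: cvg_cst.
  by apply: cvg_expr; rewrite ger0_norm; lra.
apply: (squeeze_cvgr _ (l := 1) c (cvg_cst _)).
apply: nearW => n; have x01 : 0 <= x <= 1 by lra.
have /andP[_ ->] := threshold_itv n x01; rewrite andbT.
rewrite exprMn -natrX; apply: bernoulli_onem.
by rewrite exprn_ge0// exprn_ile1//; lra.
Qed.

(** By [1 - u <= expR (- u)], [threshold n x] is at most [expR (- (2 * x) ^+ n)], hence at most the
    inverse of [(2 * x) ^+ n]. *)
Lemma cvg_threshold0 x : 2^-1 < x <= 1 -> threshold n x @[n --> \oo] --> (0 : R).
Proof.
move=> /andP[x0 x1].
have c : ((2 * x)^-1) ^+ n @[n --> \oo] --> (0 : R).
  by apply: cvg_expr; rewrite ger0_norm ?invr_ge0 ?invf_lt1; lra.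
apply: (squeeze_cvgr _ (l := 0) (cvg_cst _) c).
apply: nearW => n; have x01 : 0 <= x <= 1 by lra.
have /andP[-> _] := threshold_itv n x01; rewrite andTb.
have y0 : 0 < (2 * x) ^+ n by rewrite exprn_gt0//; lra.
rewrite exprVn (@le_trans _ _ (expR (- ((2 * x) ^+ n))))//; last first.
  rewrite expRN lef_pV2 ?posrE ?expR_gt0//.
  by rewrite (le_trans _ (expR_ge1Dx _))// lerDr.
rewrite exprMn -natrX -mulrN expRM_natl.
apply: lerXn2r; rewrite ?nnegrE ?expR_ge0 ?subr_ge0 ?exprn_ile1//; try lra.
exact: expR_ge1Dx.
Qed.

(** At 1/2 the sequence is nondecreasing, since [1 - u <= (1 - u / 2) ^+ 2] with [u = 2^-1 ^+ n]. *)
Lemma is_cvg_threshold_half : cvg (threshold n 2^-1 @[n --> \oo]).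
Proof.
have h01 : 0 <= (2^-1 : R) <= 1 by lra.
apply: (@nondecreasing_is_cvgn _ (fun n => threshold n 2^-1)).
  apply/nondecreasing_seqP => n; rewrite /threshold expnS exprM.
  have h : 0 <= (2^-1 : R) ^+ n <= 1.
    by rewrite exprn_ge0// exprn_ile1//; lra.
  case/andP: h => h0 h1; apply: lerXn2r; rewrite ?nnegrE ?sqr_ge0 ?subr_ge0//.
  by rewrite (exprS 2^-1); set u := _ ^+ n; rewrite -subr_ge0
    (_ : _ - _ = (2^-1 * u) ^+ 2) ?sqr_ge0//; field.
by exists 1 => _ [n _ <-]; have /andP[] := threshold_itv n h01.
Qed.

Lemma is_cvg_threshold x : 0 <= x <= 1 -> cvg (threshold n x @[n --> \oo]).
Proof.
move=> x01; have [xlt|xgt|->] := ltgtP x 2^-1; last exact: is_cvg_threshold_half.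
- by apply: cvgP (cvg_threshold1 _); lra.
- by apply: cvgP (cvg_threshold0 _); lra.
Qed.

End threshold.

Section trigonometric_uniqueness.
Context {R : realType} {d} {S : measurableType d}.
Variables (mu nu : probability S R) (I : Type) (X : I -> S -> R).
Hypothesis mX : forall i, measurable_fun setT (X i).

(** The phase [th] covers sines as well as cosines, so these functions stand for the real and
    imaginary parts of characters. *)
Definition trig (s : seq (R * I)) (th : R) (y : S) : R :=
  cos (th + \sum_(p <- s) p.1 * X p.2 y).

Definition bounded_measurable (F : S -> R) : Prop :=
  measurable_fun setT F /\ exists M, forall y, `|F y| <= M.

Definition trig_test (F : S -> R) : Prop := forall s th,
  \int[mu]_y (F y * trig s th y) = \int[nu]_y (F y * trig s th y).

(** Quantifying over every [F] that passes the tests, rather than testing [q] alone, makes stability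
    under products immediate; this takes the place of a monotone class argument. *)
Definition trig_mult (q : S -> R) : Prop :=
  bounded_measurable q /\ forall F, bounded_measurable F -> trig_test F ->
    trig_test (fun y => F y * q y).

Lemma measurable_trig s th : measurable_fun setT (trig s th).
Proof.
apply: measurable_fun_cos.
apply: measurable_funD => //; apply: measurable_sum => p.
exact: measurable_funM.
Qed.

Lemma bounded_measurable_trig s th : bounded_measurable (trig s th).
Proof. split; [exact: measurable_trig | by exists 1 => y; exact: cos_max]. Qed.

Lemma bounded_measurableM F G : bounded_measurable F -> bounded_measurable G ->
  bounded_measurable (fun y => F y * G y).
Proof.
move=> [mF [a Fa]] [mG [b Gb]]; split; first exact: measurable_funM.
by exists (a * b) => y; rewrite normrM ler_pM.
Qed.

Lemma bounded_measurableD F G : bounded_measurable F -> bounded_measurable G ->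
  bounded_measurable (fun y => F y + G y).
Proof.
move=> [mF [a Fa]] [mG [b Gb]]; split; first exact: measurable_funD.
by exists (a + b) => y; rewrite (le_trans (ler_normD _ _)) ?lerD.
Qed.

Lemma bounded_measurable_cst c : bounded_measurable (fun=> c).
Proof. by split; [exact: measurable_cst | exists `|c|]. Qed.

Lemma bounded_measurable_integrable (P : probability S R) F :
  bounded_measurable F -> P.-integrable setT (EFin \o F).
Proof.
move=> [mF [M FM]]; apply: measurable_bounded_integrable => //.
  by rewrite -ge0_fin_numE// fin_num_measure.
exists M; split; first exact: num_real.
by move=> x Mx y _; rewrite /= (le_trans (FM y)) // ltW.
Qed.

Lemma trig_mult_cst c : trig_mult (fun=> c).
Proof.
split; first exact: bounded_measurable_cst.
move=> F bF tF s th.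
have bFt := bounded_measurableM bF (bounded_measurable_trig s th).
transitivity (c * \int[mu]_y (F y * trig s th y)).
  rewrite -RintegralZl//; last exact: bounded_measurable_integrable.
  by apply: eq_Rintegral => y _; ring.
rewrite tF -RintegralZl//; last exact: bounded_measurable_integrable.
by apply: eq_Rintegral => y _; ring.
Qed.

Lemma trig_multM p q : trig_mult p -> trig_mult q ->
  trig_mult (fun y => p y * q y).
Proof.
move=> [bp hp] [bq hq]; split; first exact: bounded_measurableM.
move=> F bF tF.
have := hq _ (bounded_measurableM bF bp) (hp _ bF tF).
by congr trig_test; apply/funext => y; ring.
Qed.

Lemma trig_multD p q : trig_mult p -> trig_mult q ->
  trig_mult (fun y => p y + q y).
Proof.
move=> [bp hp] [bq hq]; split; first exact: bounded_measurableD.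
move=> F bF tF s th.
have bt := bounded_measurable_trig s th.
have h (P : probability S R) : \int[P]_y (F y * (p y + q y) * trig s th y) =
    \int[P]_y (F y * p y * trig s th y) + \int[P]_y (F y * q y * trig s th y).
  rewrite -RintegralD//.
  - by apply: eq_Rintegral => y _; ring.
  - apply: bounded_measurable_integrable.
    by apply: bounded_measurableM => //; exact: bounded_measurableM.
  - apply: bounded_measurable_integrable.
    by apply: bounded_measurableM => //; exact: bounded_measurableM.
by rewrite !h (hp F bF tF) (hq F bF tF).
Qed.

Lemma trig_multX q n : trig_mult q -> trig_mult (fun y => q y ^+ n).
Proof.
move=> hq; elim: n => [|n ih].
  by under eq_fun do rewrite expr0; exact: trig_mult_cst.
by under eq_fun do rewrite exprS; exact: trig_multM.
Qed.

(* Product-to-sum formula: [cos a * cos b] is again a combination of cosines. *)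
Lemma trig_mult_cos i t th : trig_mult (fun y => cos (th + t * X i y)).
Proof.
have bc : bounded_measurable (fun y => cos (th + t * X i y)).
  have := bounded_measurable_trig [:: (t, i)] th.
  by congr bounded_measurable; apply/funext => y; rewrite /trig big_seq1.
split => // F bF tF s th'.
have h (P : probability S R) :
    \int[P]_y (F y * cos (th + t * X i y) * trig s th' y) =
    2^-1 * \int[P]_y (F y * trig ((t, i) :: s) (th + th') y) +
    2^-1 * \int[P]_y (F y * trig ((- t, i) :: s) (th' - th) y).
  have intZ s' th'' :
      P.-integrable setT (EFin \o fun y => 2^-1 * (F y * trig s' th'' y)).
    apply: bounded_measurable_integrable.
    apply: bounded_measurableM; first exact: bounded_measurable_cst.
    by apply: bounded_measurableM => //; exact: bounded_measurable_trig.
  have it s' th'' : P.-integrable setT (EFin \o fun y => F y * trig s' th'' y).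
    apply: bounded_measurable_integrable.
    by apply: bounded_measurableM => //; exact: bounded_measurable_trig.
  rewrite -!RintegralZl//; [|exact: it..].
  rewrite -RintegralD//.
  - apply: eq_Rintegral => y _; rewrite /trig !big_cons/=.
    set u := th + _; set v := th' + _.
    rewrite (_ : th + th' + _ = u + v); last by rewrite /u /v; ring.
    rewrite (_ : th' - th + _ = v - u); last by rewrite /u /v; ring.
    by rewrite (cosD u v) (cosB v u); field.
by rewrite !h !tF.
Qed.

(** The uniform bound [M] gives dominated convergence under both measures, so the equality of the
    test integrals passes to the limit. *)
Lemma trig_mult_lim (q : nat -> S -> R) p M : (forall n, trig_mult (q n)) ->
  (forall n y, `|q n y| <= M) -> (forall y, q n y @[n --> \oo] --> p y) ->
  trig_mult p.
Proof.
move=> hq qM qp.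
have pM y : `|p y| <= M.
  have c : `|q n y| @[n --> \oo] --> `|p y| by apply: cvg_norm; exact: qp.
  rewrite -(cvg_lim _ c)//; apply: limr_le; first exact: cvgP c.
  by apply: nearW => n; exact: qM.
have mq n : measurable_fun setT (q n) by have [[]] := hq n.
have mp : measurable_fun setT p.
  by apply: (measurable_fun_cvg mq) => y _; exact: qp.
have bp : bounded_measurable p by split => //; exists M.
split => // F bF tF s th.
have bt := bounded_measurable_trig s th.
have [mF [K FK]] := bF.
have h (P : probability S R) : \int[P]_y (F y * q n y * trig s th y) @[n --> \oo]
    --> \int[P]_y (F y * p y * trig s th y).
  apply: fine_cvg; rewrite fineK; last first.
    apply: integrable_fin_num => //; apply: bounded_measurable_integrable.
    by do 2!apply: bounded_measurableM => //.
  apply: (@dominated_cvg _ _ _ P setT measurableT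
    (fun n y => (F y * q n y * trig s th y)%:E) _ (cst (K * M)%:E)).
  - move=> n; apply/measurable_EFinP; apply: measurable_funM.
      exact: measurable_funM.
    exact: measurable_trig.
  - move=> y _; apply: cvg_EFin; first exact: nearW.
    by apply: cvgMl; apply: cvgMr; exact: qp.
  - by [].
  - by apply: (bounded_measurable_integrable P (bounded_measurable_cst (K * M))).
  - move=> n y _; rewrite /= lee_fin !normrM -[leRHS]mulr1.
    by rewrite ler_pM// ?mulr_ge0// ?ler_pM//; exact: cos_max.
have -> : \int[mu]_y (F y * p y * trig s th y) =
    limn (fun n => \int[mu]_y (F y * q n y * trig s th y)).
  by apply/esym/cvg_lim => //; exact: h.
have -> : \int[nu]_y (F y * p y * trig s th y) =
    limn (fun n => \int[nu]_y (F y * q n y * trig s th y)).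
  by apply/esym/cvg_lim => //; exact: h.
congr (limn _); apply/funext => n.
by have [_ hn] := hq n; exact: hn.
Qed.

Lemma trig_mult_threshold q : trig_mult q -> (forall y, 0 <= q y <= 1) ->
  trig_mult (fun y => limn (fun n => threshold n (q y))).
Proof.
move=> hq q01; apply: (@trig_mult_lim (fun n y => threshold n (q y)) _ 1).
- move=> n; apply: trig_multX; apply: trig_multD; first exact: trig_mult_cst.
  under eq_fun do rewrite -mulN1r.
  by apply: trig_multM; [exact: trig_mult_cst|exact: trig_multX].
- move=> n y; have /andP[t0 t1] := threshold_itv n (q01 y).
  by rewrite ger0_norm.
- by move=> y; exact: is_cvg_threshold.
Qed.

(** Once [N] is large, [u / N.+1] lies in []-pi, pi[], where the sine has the sign of [u]; comparing
    this function with 1/2 then detects that sign. It is a multiplier because a sine is a cosine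
    with a shifted phase. *)
Let half_sine N (u : R) := 2^-1 + 2^-1 * sin (N.+1%:R^-1 * u).

Let half_sine_itv N u : 0 <= half_sine N u <= 1.
Proof.
have := sin_geN1 (N.+1%:R^-1 * u); have := sin_le1 (N.+1%:R^-1 * u).
by rewrite /half_sine; lra.
Qed.

(* The value at 0 is only known to lie in [0, 1]; it disappears when rays
   [X i < a - e] are used to approximate [X i < a]. *)
Let ray_limit (u : R) : R :=
  if u < 0 then 1 else if 0 < u then 0 else limn (fun n => threshold n 2^-1).

Let cvg_ray_limit u :
  limn (fun n => threshold n (half_sine N u)) @[N --> \oo] --> ray_limit u.
Proof.
apply: cvg_near_cst; near=> N.
have uN : `|u| < N.+1%:R.
  rewrite (@lt_trans _ _ N%:R) ?ltr_nat//; near: N; exact: nbhs_infty_gtr.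
have pi2 := pi_ge2 R.
have N0 : 0 < (N.+1%:R : R)^-1 by rewrite invr_gt0.
have sp (v : R) : 0 < v -> v < N.+1%:R -> 0 < sin (N.+1%:R^-1 * v).
  move=> v0 vN; apply: sin_gt0_pi; rewrite mulr_gt0//= mulrC ltr_pdivrMr//.
  by rewrite (lt_le_trans vN)// ler_peMl//; lra.
have s01 := half_sine_itv N u.
rewrite /ray_limit; have [u0|u0|->] := ltgtP u 0.
- apply/cvg_lim => //; apply: cvg_threshold1.
  have := sp (- u); rewrite mulrN sinN oppr_gt0 => /(_ u0).
  rewrite ltr0_norm// in uN => /(_ uN); move: s01; rewrite /half_sine; lra.
- apply/cvg_lim => //; apply: cvg_threshold0.
  have := sp u u0; rewrite gtr0_norm// in uN => /(_ uN).
  by move: s01; rewrite /half_sine; lra.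
- by rewrite /half_sine mulr0 sin0 mulr0 addr0.
Unshelve. all: end_near. Qed.

Let ray_limit_itv u : 0 <= ray_limit u <= 1.
Proof.
have h01 : 0 <= (2^-1 : R) <= 1 by lra.
rewrite /ray_limit; case: ifP => _; first by lra.
case: ifP => _; first by lra.
apply/andP; split.
  apply: limr_ge; first exact: is_cvg_threshold.
  by apply: nearW => n; have /andP[] := threshold_itv n h01.
apply: limr_le; first exact: is_cvg_threshold.
by apply: nearW => n; have /andP[] := threshold_itv n h01.
Qed.

Lemma trig_mult_ray i (a : R) : trig_mult (fun y => (X i y < a)%R%:R).
Proof.
have hN b N : trig_mult (fun y => half_sine N (X i y - b)).
  apply: trig_multD; first exact: trig_mult_cst.
  apply: trig_multM; first exact: trig_mult_cst.
  have := trig_mult_cos i N.+1%:R^-1 (- (N.+1%:R^-1 * b) - pi / 2).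
  congr trig_mult; apply/funext => y; rewrite -cosBpihalf; congr cos; ring.
have hl b : trig_mult (fun y => ray_limit (X i y - b)).
  apply: (@trig_mult_lim (fun N y =>
    limn (fun n => threshold n (half_sine N (X i y - b)))) _ 1) => [N|N y|y].
  - exact: trig_mult_threshold.
  - have h := half_sine_itv N (X i y - b).
    rewrite ger0_norm.
      apply: limr_le; first exact: is_cvg_threshold.
      by apply: nearW => n; have /andP[] := threshold_itv n h.
    apply: limr_ge; first exact: is_cvg_threshold.
    by apply: nearW => n; have /andP[] := threshold_itv n h.
  - exact: cvg_ray_limit.
apply: (@trig_mult_lim (fun k y => ray_limit (X i y - (a - k.+1%:R^-1))) _ 1).
- by move=> k; exact: hl.
- by move=> k y; have /andP[? ?] := ray_limit_itv (X i y - (a - k.+1%:R^-1));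
    rewrite ger0_norm.
- move=> y; apply: cvg_near_cst.
  have [Xa|Xa] := ltP (X i y) a.
    have aX0 : 0 < a - X i y by rewrite subr_gt0.
    apply: filterS (near_infty_natSinv_lt (PosNum aX0)) => k ka.
    have {}ka : k.+1%:R^-1 < a - X i y := ka.
    by rewrite /ray_limit; move: (k.+1%:R^-1) ka => e ka; rewrite ifT//; lra.
  apply: nearW => k; have : 0 < (k.+1%:R : R)^-1 by rewrite invr_gt0.
  rewrite /ray_limit; move: (k.+1%:R^-1) => e e0.
  by rewrite ifF ?ifT//; [lra|apply/negbTE; rewrite -leNgt; lra].
Qed.

Definition trig_class (A : set S) := measurable A /\ trig_mult \1_A.

(** Complements come from [1 - q]. The indicator of a countable union is the limit of
    [1 - \prod_(k < n) (1 - \1_(A k))], which at each point is eventually constant. *)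
Lemma trig_class_sigma_algebra : sigma_algebra setT trig_class.
Proof.
split.
- by split => //; rewrite indic0; exact: trig_mult_cst.
- move=> A [mA hA]; rewrite setTD; split; first exact: measurableC.
  have := trig_multD (trig_mult_cst 1) (trig_multM (trig_mult_cst (-1)) hA).
  by congr trig_mult; apply/funext => y; rewrite !indicE in_setC;
    case: (_ \in A) => /=; ring.
- move=> A hA; split; first by apply: bigcup_measurable => k _; have [] := hA k.
  have hP n : trig_mult (fun y => \prod_(k < n) (1 - \1_(A k) y)).
    elim: n => [|n ih].
      by under eq_fun do rewrite big_ord0; exact: trig_mult_cst.
    under eq_fun do rewrite big_ord_recr/=.
    apply: trig_multM => //; apply: trig_multD; first exact: trig_mult_cst.
    under eq_fun do rewrite -mulN1r.
    by apply: trig_multM; [exact: trig_mult_cst|have [] := hA n].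
  apply: (@trig_mult_lim (fun n y => 1 - \prod_(k < n) (1 - \1_(A k) y)) _ 1).
  + move=> n; apply: trig_multD; first exact: trig_mult_cst.
    under eq_fun do rewrite -mulN1r.
    by apply: trig_multM; [exact: trig_mult_cst|exact: hP].
  + move=> n y; have : 0 <= \prod_(k < n) (1 - \1_(A k) y : R) <= 1.
      apply: (big_ind (fun u : R => 0 <= u <= 1)) => [|u v|k _].
      * by rewrite ler01 lexx.
      * by move=> /andP[u0 u1] /andP[v0 v1]; rewrite mulr_ge0//= mulr_ile1.
      * by rewrite subr_ge0 indicE lern1 leq_b1 gerBl ler0n.
    by case/andP => h0 h1; rewrite ger0_norm; lra.
  + move=> y; apply: cvg_near_cst; rewrite indicE.
    have [/set_mem[k _ Aky]|nAy] := boolP (y \in \bigcup_k A k).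
      exists k.+1 => // n /= kn.
      by rewrite (bigD1 (Ordinal kn))//= indicE mem_set// subrr mul0r subr0.
    apply: nearW => n; rewrite big1 ?subrr// => k _.
    rewrite indicE memNset ?subr0// => Aky.
    by move/negP: nAy; apply; rewrite inE; exists k.
Qed.

(* Cramer-Wold: the class of the events whose indicator can be inserted in all
   the test integrals is a sigma-algebra containing the events [X i < a]. *)
Lemma trig_uniqueness :
  (forall s th, \int[mu]_y trig s th y = \int[nu]_y trig s th y) ->
  forall A, <<s [set A | exists i (B : set R),
                  measurable B /\ A = X i @^-1` B] >> A ->
  mu A = nu A.
Proof.
move=> h A GA.
have [mA hA] : trig_class A.
  apply: GA; split; first exact: trig_class_sigma_algebra.
  move=> _ [i [B0 [mB0 ->]]]; move: B0 mB0.
  pose C : set (set R) := [set B | trig_class (X i @^-1` B)].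
  have sC : sigma_algebra setT C.
    have [t0 tC tU] := trig_class_sigma_algebra.
    split => [|B hB|B hB].
    - by rewrite /C/= preimage_set0.
    - by rewrite /C/= setTD preimage_setC -setTD; exact: tC.
    - by rewrite /C/= preimage_bigcup; exact: tU.
  have mE : @measurable _ (measurableTypeR R) = <<s @RGenInftyO.G R >>.
    exact: RGenInftyO.measurableE.
  suff GC : <<s @RGenInftyO.G R >> `<=` C by move=> B mB; apply: GC; rewrite -mE.
  apply: smallest_sub => // _ [a ->]; split.
    by rewrite -[_ @^-1` _]setTI; apply: mX.
  have := trig_mult_ray i a; congr trig_mult; apply/funext => y.
  rewrite indicE; congr ((nat_of_bool _)%:R).
  by apply/idP/idP; rewrite inE /= in_itv.
(* The constant 1 passes the tests by hypothesis, hence so does [\1_A]; the test with no frequency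
   and phase 0 integrates [\1_A] itself. *)
have tA : trig_test (fun y => 1 * \1_A y).
  apply: hA.2; first exact: bounded_measurable_cst.
  move=> s th.
  by under eq_Rintegral do rewrite mul1r; under [RHS]eq_Rintegral do rewrite mul1r.
have hI (P : probability S R) :
    P A = (\int[P]_y (1 * \1_A y * trig [::] 0 y))%:E.
  under eq_Rintegral do rewrite mul1r /trig big_nil addr0 cos0 mulr1.
  rewrite /Rintegral integral_indic// setIT fineK//; exact: fin_num_measure.
by rewrite !hI tA.
Qed.

End trigonometric_uniqueness.

(** * The standard normal distribution *)

Section normal_integral.
Context {R : realType}.
Notation mu := (@lebesgue_measure R).

(** The density and the Radon-Nikodym derivative have the same integral over every measurable set,
    hence agree almost everywhere. *)
Lemma ge0_integral_normal_prob (m s : R) (f : R -> \bar R) :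
  (forall x, 0 <= f x)%E -> measurable_fun setT f ->
  (\int[normal_prob m s]_x f x = \int[mu]_x (f x * (normal_pdf m s x)%:E))%E.
Proof.
move=> f0 mf.
have dom := normal_prob_dominates m s.
rewrite -(Radon_Nikodym_SigmaFinite.change_of_variables dom f0 measurableT mf).
have mpdf : measurable_fun setT (fun x => (normal_pdf m s x)%:E).
  by apply/measurable_EFinP; exact: measurable_normal_pdf.
have mRN := measurable_int _ (Radon_Nikodym_SigmaFinite.f_integrable dom).
apply: ae_eq_integral => //.
- by apply: emeasurable_funM => //; exact: mRN.
- exact: emeasurable_funM.
- apply: ae_eqe_mul2l; apply: integral_ae_eq => //.
    exact: Radon_Nikodym_SigmaFinite.f_integrable.
  by move=> E _ mE; rewrite -Radon_Nikodym_SigmaFinite.f_integral.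
Qed.

Lemma integrable_normal_probE (m s : R) (f : R -> R) : measurable_fun setT f ->
  (normal_prob m s).-integrable setT (EFin \o f) <->
  mu.-integrable setT (fun x => (f x * normal_pdf m s x)%:E).
Proof.
move=> mf; have mfphi : measurable_fun setT (fun x => (f x * normal_pdf m s x)%:E).
  apply/measurable_EFinP; apply: measurable_funM => //.
  exact: measurable_normal_pdf.
have E : (\int[normal_prob m s]_x `|(EFin \o f) x| =
          \int[mu]_x `|(f x * normal_pdf m s x)%:E|)%E.
  rewrite ge0_integral_normal_prob//; last first.
    by apply: measurableT_comp => //; exact/measurable_EFinP.
  apply: eq_integral => x _ /=.
  by rewrite normrM EFinM (ger0_norm (normal_pdf_ge0 _ _ _)).
split => /integrableP[_ fi]; apply/integrableP; split.
- exact: mfphi.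
- by rewrite -E.
- exact/measurable_EFinP.
- by rewrite E.
Qed.

Lemma integral_normal_prob (m s : R) (f : R -> R) : measurable_fun setT f ->
  (normal_prob m s).-integrable setT (EFin \o f) ->
  (\int[normal_prob m s]_x (f x)%:E = \int[mu]_x (f x * normal_pdf m s x)%:E)%E.
Proof.
move=> mf fi.
have dom := normal_prob_dominates m s.
rewrite -(Radon_Nikodym_change_of_variables dom measurableT fi).
have mpdf : measurable_fun setT (fun x => (normal_pdf m s x)%:E).
  by apply/measurable_EFinP; exact: measurable_normal_pdf.
under [RHS]eq_integral do rewrite EFinM.
apply: ae_eq_integral => //.
- by apply: emeasurable_funM => //; exact/measurable_EFinP.
- by apply: emeasurable_funM => //; exact/measurable_EFinP.
- apply: ae_eqe_mul2l; apply: integral_ae_eq => //.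
    by apply: Radon_Nikodym_integrable; exact: dom.
  by move=> E _ mE; rewrite -Radon_Nikodym_integral//; exact: dom.
Qed.

Lemma lebesgue_measure_shift (a : R) (A : set R) : measurable A ->
  pushforward mu (fun x : measurableTypeR R => x + a : measurableTypeR R) A = mu A.
Proof.
have ms : measurable_fun setT (fun x : measurableTypeR R => x + a : measurableTypeR R).
  exact: measurable_funD.
move=> mA; apply/esym.
apply: (@lebesgue_measure_unique _ (pushforward mu _)) => //= _ [[c b]] _ <-.
rewrite /pushforward.
rewrite (_ : _ @^-1` _ = `]c - a, b - a]%classic); last first.
  by apply/seteqP; split => x /=; rewrite !in_itv/= ltrBlDr lerBrDr.
rewrite !lebesgue_measure_itv/= !lte_fin ltrD2r.
by case: ifP => // _; rewrite -!EFinD; congr (_%:E); ring.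
Qed.

(** The fundamental theorem of calculus on [[-n, n]], extended to the line by dominated convergence.
    It yields the mean of the standard normal law and Stein's identity. *)
Lemma integral_total_derivative (F f : R -> R) : continuous f ->
  (forall x : R, is_derive x (1 : R) F (f x)) -> mu.-integrable setT (EFin \o f) ->
  F n%:R - F (- n%:R) @[n --> \oo] --> (0 : R) ->
  (\int[mu]_x (f x)%:E = 0)%E.
Proof.
move=> cf dF fi F0.
have mf := measurable_int _ fi.
pose I (n : nat) : set R := `[- n%:R, n%:R]%classic.
have c1 : (\int[mu]_(x in I n) (f x)%:E @[n --> \oo] --> \int[mu]_x (f x)%:E)%E.
  under eq_fun do rewrite integral_mkcond.
  apply: (@dominated_cvg _ _ _ mu setT measurableT _ _ (fun x => `|(f x)%:E|)%E).
  - move=> n; apply/(measurable_restrictT _ (measurable_itv _)).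
    exact: measurable_funS mf.
  - move=> x _; apply: cvg_near_cst; near=> n.
    rewrite patchE mem_set// /I/= in_itv/= -ler_norml ltW//.
    by near: n; exact: nbhs_infty_gtr.
  - by move=> x _.
  - exact: integrable_abse.
  - move=> n x _; rewrite patchE; case: ifP => // _.
    by rewrite abse0 abse_ge0.
have c2 : (\int[mu]_(x in I n) (f x)%:E @[n --> \oo] --> (0 : R)%:E)%E.
  (* At [n = 0] the interval is a single point, whereas the fundamental theorem of calculus is
     applied with distinct endpoints. *)
  rewrite -cvg_shiftS.
  have -> : (fun n => \int[mu]_(x in I n.+1) (f x)%:E)%E =
      (fun n => (F n.+1%:R - F (- n.+1%:R))%:E).
    apply/funext => n; rewrite EFinB; apply: continuous_FTC2.
    - by have := ltr0Sn R n; lra.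
    - exact: continuous_subspaceT.
    - have cF x : {for x, continuous F}.
        by apply: differentiable_continuous; apply/derivable1_diffP; exact: ex_derive.
      split; first by move=> x _; exact: ex_derive.
        by apply: cvg_at_right_filter; exact: cF.
      by apply: cvg_at_left_filter; exact: cF.
    - by move=> x _; rewrite derive1E; exact: derive_val.
  by apply: cvg_EFin; [exact: nearW|rewrite (cvg_shiftS (fun n => F n%:R - F (- n%:R)))].
by rewrite -(cvg_lim _ c1)// (cvg_lim _ c2).
Unshelve. all: end_near. Qed.

End normal_integral.

Lemma cvg_prob_ley {R : realType} d (S : measurableType d) (Q : probability S R)
    (X : S -> R) : measurable_fun setT X ->
  fine (Q [set y | X y <= x]) @[x --> +oo] --> (1 : R).
Proof.
move=> mX; have X_ := isMeasurableFun.Build _ _ _ _ _ mX.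
by have /fine_cvg := @cvg_cdfy1 _ _ _ Q (MeasurableFun.Pack (MeasurableFun.Class X_)).
Qed.

Lemma cvg_prob_leNy {R : realType} d (S : measurableType d) (Q : probability S R)
    (X : S -> R) : measurable_fun setT X ->
  fine (Q [set y | X y <= x]) @[x --> -oo] --> (0 : R).
Proof.
move=> mX; have X_ := isMeasurableFun.Build _ _ _ _ _ mX.
by have /fine_cvg := @cvg_cdfNy0 _ _ _ Q (MeasurableFun.Pack (MeasurableFun.Class X_)).
Qed.

Section standard_normal.
Context {R : realType}.
Notation mu := (@lebesgue_measure R).
Notation phi := (@normal_pdf R 0 1).
Notation gamma := (@normal_prob R 0 1).

Lemma stdnormal_pdfE (x : R) : phi x = normal_peak 1 * expR (- (x ^+ 2 / 2)).
Proof.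
by rewrite normal_pdfE ?oner_neq0// /normal_fun subr0 mulNr expr1n.
Qed.

Lemma is_derive_stdnormal_pdf (x : R) : is_derive x (1 : R) phi (- x * phi x).
Proof.
have -> : phi = (fun x => normal_peak 1 * expR (- (x ^+ 2 / 2))).
  by apply/funext => y; exact: stdnormal_pdfE.
apply: is_derive_eq; rewrite /GRing.scale/=.
by rewrite !(mulr0, addr0, add0r, mulr1); field.
Qed.

Lemma stdnormal_pdfN (x : R) : phi (- x) = phi x.
Proof. by rewrite !stdnormal_pdfE sqrrN. Qed.

Lemma cvg_stdnormal_pdf_natr : phi n%:R @[n --> \oo] --> (0 : R).
Proof.
have c : (2 * normal_peak 1) * n.+1%:R^-1 @[n --> \oo] --> (0 : R).
  rewrite -[X in _ --> X](mulr0 (2 * @normal_peak R 1)).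
  by apply: cvgMr; exact: cvg_harmonic.
apply: (squeeze_cvgr _ (l := 0) (cvg_cst _) c).
apply: nearW => n; rewrite normal_pdf_ge0/= stdnormal_pdfE.
rewrite (_ : 2 * _ / _ = normal_peak 1 * (2 / n.+1%:R)); last by ring.
apply: ler_wpM2l; first exact: normal_peak_ge0.
have h0 : 0 < n.+1%:R / 2 :> R by rewrite divr_gt0.
have h1 : n.+1%:R / 2 <= expR (n%:R ^+ 2 / 2) :> R.
  rewrite (le_trans _ (expR_ge1Dx _))// -[n.+1]addn1 natrD.
  by have := ler0n R n; have := sqr_ge0 (n%:R - 1 : R); rewrite sqrrB; lra.
by rewrite expRN -(invf_div n.+1%:R 2) lef_pV2 ?posrE ?expR_gt0.
Qed.

(** Domination by a multiple of the density of variance 2, as [|x| <= 1 + x ^+ 2 / 4 <= expR (x ^+ 2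
    / 4)]. *)
Lemma integrable_id_stdnormal_pdf : mu.-integrable setT (fun x : R => (x * phi x)%:E).
Proof.
pose s : R := Num.sqrt 2.
have s0 : s != 0 by rewrite gt_eqF// sqrtr_gt0.
pose c : R := normal_peak 1 / normal_peak s.
apply: (@le_integrable _ _ _ mu setT measurableT _
    (fun x => c%:E * (normal_pdf 0 s x)%:E)%E).
- apply/measurable_EFinP; apply: measurable_funM => //.
  exact: measurable_normal_pdf.
- move=> x _; rewrite /= lee_fin normrM (ger0_norm (normal_pdf_ge0 _ _ _)).
  rewrite [leRHS]ger0_norm; last first.
    by rewrite !mulr_ge0 ?normal_pdf_ge0 ?invr_ge0 ?normal_peak_ge0.
  rewrite (normal_pdfE _ s0) stdnormal_pdfE /c.
  rewrite [leRHS]mulrA divfK ?gt_eqF ?normal_peak_gt0//.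
  rewrite mulrCA ler_wpM2l ?normal_peak_ge0// /normal_fun subr0 sqr_sqrtr//.
  have -> : - x ^+ 2 / (2 *+ 2) = x ^+ 2 / 4 + - (x ^+ 2 / 2) by field.
  rewrite expRD ler_wpM2r ?expR_ge0// (le_trans _ (expR_ge1Dx _))//.
  have := sqr_ge0 (`|x| - 2); rewrite sqrrB real_normK ?num_real//; lra.
- by apply: integrableZl => //; exact: integrable_normal_pdf.
Qed.

Lemma integrable_stdnormal_id : gamma.-integrable setT (fun x : R => x%:E).
Proof.
by apply/(@integrable_normal_probE _ _ _ id) => //; exact: integrable_id_stdnormal_pdf.
Qed.

Lemma integral_stdnormal_id : (\int[gamma]_x x%:E = 0)%E.
Proof.
rewrite (@integral_normal_prob _ _ _ id) => //; last exact: integrable_stdnormal_id.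
apply: (@integral_total_derivative _ (fun x => - phi x)).
- by move=> x; apply: cvgM => //; apply: continuous_normal_pdf; rewrite oner_neq0.
- move=> x; have dphi := is_derive_stdnormal_pdf x.
  by apply: is_derive_eq; rewrite mulNr opprK.
- exact: integrable_id_stdnormal_pdf.
- by under eq_fun do rewrite stdnormal_pdfN subrr; exact: cvg_cst.
Qed.

(** The characteristic function: its imaginary part vanishes by symmetry, see [stdnormal_sin]. *)
Definition stdnormal_cf (t : R) : R := \int[gamma]_x cos (t * x).

Lemma bounded_stdnormal_integrable (f : R -> R) : measurable_fun setT f ->
  (forall x, `|f x| <= 1) -> gamma.-integrable setT (EFin \o f).
Proof.
move=> mf f1; apply: measurable_bounded_integrable => //.
  by rewrite -ge0_fin_numE// fin_num_measure.
by exists 1; split=> // x x1 y _; rewrite /= (le_trans (f1 y)) // ltW.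
Qed.

Lemma measurable_cosM (t : R) : measurable_fun setT (fun x : R => cos (t * x)).
Proof.
by apply: measurable_fun_cos; exact: measurable_funM.
Qed.

Lemma measurable_sinM (t : R) : measurable_fun setT (fun x : R => sin (t * x)).
Proof.
by apply: measurable_fun_sin; exact: measurable_funM.
Qed.

Lemma integrable_id_sin_stdnormal (t : R) :
  gamma.-integrable setT (fun x : R => (x * sin (t * x))%:E).
Proof.
apply: (le_integrable _ _ _ integrable_stdnormal_id) => //.
  by apply/measurable_EFinP; apply: measurable_funM => //; exact: measurable_sinM.
by move=> x _; rewrite /= lee_fin normrM ler_piMr ?sin_max.
Qed.

(* Stein's identity: integrating the derivative of [sin (t * x) * phi x]. *)
Lemma stdnormal_stein_sin (t : R) :
  \int[gamma]_x (x * sin (t * x)) = t * stdnormal_cf t.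
Proof.
have mc := measurable_cosM t; have ms := measurable_sinM t.
have ic := bounded_stdnormal_integrable mc (fun x => cos_max _).
have is_ := integrable_id_sin_stdnormal t.
have h : (\int[gamma]_x (t * cos (t * x) - x * sin (t * x))%:E = 0)%E.
  have mf : measurable_fun setT (fun x : R => t * cos (t * x) - x * sin (t * x)).
    by apply: measurable_funB; exact: measurable_funM.
  have fi : gamma.-integrable setT
      (EFin \o fun x : R => t * cos (t * x) - x * sin (t * x)).
    have -> : (EFin \o fun x : R => t * cos (t * x) - x * sin (t * x)) =
        (fun x => t%:E * (cos (t * x))%:E - (x * sin (t * x))%:E)%E by [].
    by apply: integrableB => //; exact: integrableZl.
  rewrite integral_normal_prob//.
  apply: (@integral_total_derivative _ (fun x => sin (t * x) * phi x)).
  - have ct : continuous (fun x : R => t * x) by move=> x; exact: mulrl_continuous.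
    move=> x; apply: cvgM; last by apply: continuous_normal_pdf; rewrite oner_neq0.
    apply: cvgB; apply: cvgM => //; first exact: cvg_cst.
      exact: (continuous_comp (ct x) (@continuous_cos R _)).
    exact: (continuous_comp (ct x) (@continuous_sin R _)).
  - move=> x; have dphi := is_derive_stdnormal_pdf x.
    apply: is_derive_eq; rewrite /GRing.scale/=; ring.
  - exact/(integrable_normal_probE _ _ mf).
  - apply: (squeeze_cvgr _ (l := 0)); last first.
    + have : 2 * phi n%:R @[n --> \oo] --> (2 * 0 : R).
        by apply: cvgMr; exact: cvg_stdnormal_pdf_natr.
      by rewrite mulr0; exact.
    + have : - (2 * phi n%:R) @[n --> \oo] --> - (2 * 0 : R).
        by apply: cvgN; apply: cvgMr; exact: cvg_stdnormal_pdf_natr.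
      by rewrite mulr0 oppr0; exact.
    + apply: nearW => n; rewrite stdnormal_pdfN mulrN sinN -mulrBl opprK -ler_norml.
      rewrite normrM (ger0_norm (normal_pdf_ge0 _ _ _)) ler_wpM2r ?normal_pdf_ge0//.
      by rewrite (le_trans (ler_normD _ _))// lerD ?sin_max.
have {h} : \int[gamma]_x (t * cos (t * x) - x * sin (t * x)) = 0.
  by rewrite /Rintegral h.
have itc : gamma.-integrable setT (EFin \o fun x : R => t * cos (t * x)).
  have := integrableZl measurableT t ic.
  by congr (_ .-integrable _ _); apply/funext => x /=; rewrite EFinM.
rewrite RintegralB//.
by rewrite RintegralZl// => /subr0_eq ->.
Qed.

(** Differentiation under the integral sign, dominated by [|x|], followed by Stein's identity: a
    linear differential equation for the characteristic function. *)
Lemma is_derive_stdnormal_cf (t : R) :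
  is_derive t (1 : R) stdnormal_cf (- t * stdnormal_cf t).
Proof.
have d1 (s x : R) : is_derive s (1 : R) (fun u : R => cos (u * x)) (- (x * sin (s * x))).
  by apply: is_derive_eq; rewrite /GRing.scale/=; ring.
have I01 : (`]t - 1, t + 1[%classic : set R) t by rewrite /= in_itv/=; lra.
have ic (s : R) : gamma.-integrable setT (EFin \o fun x : R => cos (s * x)).
  by apply: bounded_stdnormal_integrable => [|x]; [exact: measurable_cosM|exact: cos_max].
have dcos (s x : R) : partial1of2 (fun u y : R => cos (u * y)) s x = - (x * sin (s * x)).
  by rewrite partial1of2E; exact: derive_val.
have der (s x : R) : derivable (fun u : R => cos (u * x)) s 1 by exact: ex_derive.
have ig : gamma.-integrable setT (EFin \o fun x : R => `|x|).
  exact: integrable_abse integrable_stdnormal_id.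
have ub (s x : R) : `|partial1of2 (fun u y : R => cos (u * y)) s x| <= `|x|.
  by rewrite dcos normrN normrM ler_piMr ?sin_max.
apply: DeriveDef.
  exact: (derivable_under_integral measurableT I01 (fun s _ => ic s)
    (fun s x _ _ => der s x) (@normr_ge0 _ _) ig (fun s x _ _ => ub s x)).
rewrite -derive1E (differentiation_under_integral measurableT I01 (fun s _ => ic s)
    (fun s x _ _ => der s x) (@normr_ge0 _ _) ig (fun s x _ _ => ub s x)).
rewrite mulNr -stdnormal_stein_sin -mulN1r -RintegralZl//; last first.
  exact: integrable_id_sin_stdnormal.
by apply: eq_Rintegral => x _; rewrite dcos mulN1r.
Qed.

(** The differential equation makes [stdnormal_cf u * expR (u ^+ 2 / 2)] constant, and its value at
    0 is 1. *)
Lemma stdnormal_cfE (t : R) : stdnormal_cf t = expR (- (t ^+ 2 / 2)).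
Proof.
have d (s : R) : is_derive s (1 : R) (fun u => stdnormal_cf u * expR (u ^+ 2 / 2)) 0.
  have := is_derive_stdnormal_cf s => ds.
  by apply: is_derive_eq; rewrite /GRing.scale/=; field.
have := is_derive_0_is_cst t 0 d.
rewrite expr0n/= mul0r expR0 mulr1 expRN => h.
have h0 : stdnormal_cf 0 = 1.
  rewrite /stdnormal_cf; under eq_Rintegral do rewrite mul0r cos0.
  rewrite Rintegral_cst// mul1r -[RHS]/(fine 1%:E); congr fine.
  exact: (@probability_setT _ _ _ gamma).
have e0 : expR (t ^+ 2 / 2) != 0 by rewrite gt_eqF ?expR_gt0.
by apply: (mulIf e0); rewrite h h0 mulVf.
Qed.

Lemma stdnormal_probN (A : set R) : measurable A ->
  gamma ((-%R : R -> R) @^-1` A) = gamma A.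
Proof.
move=> mA; rewrite /normal_prob.
transitivity (\int[mu]_(x in (-%R : measurableTypeR R -> measurableTypeR R) @^-1` A)
    (((EFin \o phi) \o (-%R : measurableTypeR R -> measurableTypeR R)) x))%E.
  by apply: eq_integral => x _ /=; rewrite stdnormal_pdfN.
rewrite -ge0_integral_pushforward//.
- apply: eq_measure_integral => B mB _; exact: lebesgue_measureN.
- by apply/measurable_EFinP/measurable_funTS; exact: measurable_normal_pdf.
- by move=> x _; rewrite lee_fin normal_pdf_ge0.
Qed.

Lemma stdnormal_sin (t : R) : \int[gamma]_x sin (t * x) = 0.
Proof.
have is_ : gamma.-integrable setT (EFin \o fun x : R => sin (t * x)).
  by apply: bounded_stdnormal_integrable => [|x]; [exact: measurable_sinM|exact: sin_max].
have ms := measurable_sinM t.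
have msN : measurable_fun setT ((fun x : R => sin (t * x)) \o (-%R : R -> R)).
  exact: measurableT_comp.
have E : \int[gamma]_x sin (t * x) = \int[gamma]_x sin (t * - x).
  rewrite /Rintegral; congr fine.
  transitivity (\int[pushforward gamma
      (-%R : measurableTypeR R -> measurableTypeR R)]_x (sin (t * x))%:E)%E.
    by apply: eq_measure_integral => A mA _; exact/esym/stdnormal_probN.
  rewrite integral_pushforward//.
    exact/measurable_EFinP.
  apply: (@bounded_stdnormal_integrable (fun x => sin (t * - x))) => // x.
  exact: sin_max.
move: E; under [RHS]eq_Rintegral do rewrite mulrN sinN -mulN1r.
by rewrite RintegralZl//; lra.
Qed.

Notation Phi := (@stdnormal_cdf R).

Lemma EFin_stdnormal_cdf (x : R) : (Phi x)%:E = gamma `]-oo, x].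
Proof. by rewrite /stdnormal_cdf fineK// fin_num_measure. Qed.

Lemma stdnormal_ccdf (x : R) : gamma `[- x, +oo[ = (Phi x)%:E.
Proof.
have E (y : R) : (y \in `[- x, +oo[) = (- y \in `]-oo, x]).
  by rewrite !in_itv/= andbT lerNl.
have -> : `[- x, +oo[%classic = (-%R : R -> R) @^-1` `]-oo, x]%classic.
  by apply/funext => y; rewrite /preimage /mkset; congr is_true; exact: E.
by rewrite EFin_stdnormal_cdf stdnormal_probN.
Qed.

Lemma stdnormal_prob_itv_split (x y : R) : x <= y ->
  gamma `]-oo, y] = (gamma `]-oo, x] + gamma `]x, y])%E.
Proof.
move=> xy.
have -> : `]-oo, y]%classic = `]-oo, x]%classic `|` `]x, y]%classic :> set R.
  by rewrite -itv_bndbnd_setU// bnd_simp.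
apply: measureU => //; rewrite -subset0 => z [] /=; rewrite !in_itv/= => zx.
by rewrite ltNge zx.
Qed.

Lemma stdnormal_cdf_incr (x y : R) : x < y -> Phi x < Phi y.
Proof.
move=> xy; rewrite -lte_fin !EFin_stdnormal_cdf.
rewrite (stdnormal_prob_itv_split (ltW xy)).
rewrite lteDl ?fin_num_measure//.
(* Every [z] in []x, y]] satisfies [z ^+ 2 <= x ^+ 2 + y ^+ 2], so [c] is a positive lower bound of
   the density there. *)
pose c : R := normal_peak 1 * expR (- ((x ^+ 2 + y ^+ 2) / 2)).
have c0 : 0 < c by rewrite mulr_gt0 ?expR_gt0// normal_peak_gt0 ?oner_neq0.
apply: (@lt_le_trans _ _ (\int[mu]_(z in `]x, y]) c%:E)%E).
  rewrite integral_cst//= lebesgue_measure_itv/= lte_fin xy -EFinD -EFinM lte_fin.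
  by rewrite mulr_gt0// subr_gt0.
apply: ge0_le_integral => //=.
- by move=> z _; rewrite lee_fin ltW.
- by apply/measurable_EFinP/measurable_funTS; exact: measurable_normal_pdf.
move=> z; rewrite in_itv/= => /andP[xz zy].
rewrite lee_fin stdnormal_pdfE ler_wpM2l ?normal_peak_ge0// ler_expR lerN2.
rewrite ler_wpM2r//.
have [z0|z0] := leP 0 z; nra.
Qed.

Lemma stdnormal_cdf_lipschitz (x y : R) : x <= y ->
  Phi y - Phi x <= normal_peak 1 * (y - x).
Proof.
move=> xy; rewrite lerBlDl -lee_fin EFinD !EFin_stdnormal_cdf.
rewrite (stdnormal_prob_itv_split xy).
rewrite leeD2l//.
apply: (@le_trans _ _ (\int[mu]_(z in `]x, y]) (normal_peak 1)%:E)%E).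
  apply: ge0_le_integral => //=.
  - by move=> z _; rewrite lee_fin normal_pdf_ge0.
  - by apply/measurable_EFinP/measurable_funTS; exact: measurable_normal_pdf.
  - by move=> z _; rewrite lee_fin normal_pdf_ub ?oner_neq0.
rewrite integral_cst//= lebesgue_measure_itv/= lte_fin.
case: ifP => [_|]; first by rewrite -EFinD -EFinM.
by rewrite mule0 lee_fin mulr_ge0 ?normal_peak_ge0// subr_ge0.
Qed.

Lemma continuous_stdnormal_cdf : continuous Phi.
Proof.
have p0 : 0 < @normal_peak R 1 by rewrite normal_peak_gt0 ?oner_neq0.
have h (x y : R) : `|Phi x - Phi y| <= normal_peak 1 * `|x - y|.
  wlog xy : x y / x <= y.
    move=> hw; have [/hw//|/ltW/hw] := leP x y.
    by rewrite distrC (distrC x).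
  rewrite distrC (distrC x) !ger0_norm ?subr_ge0//; first exact: stdnormal_cdf_lipschitz.
  by move: xy; rewrite le_eqVlt => /predU1P[->//|/stdnormal_cdf_incr/ltW].
move=> x; apply/cvgrPdist_lt => e e0; near=> y.
rewrite (le_lt_trans (h x y))// mulrC -ltr_pdivlMr//.
near: y; apply: cvgr_dist_lt => //; exact: divr_gt0.
Unshelve. all: end_near. Qed.

Lemma stdnormal_cdf_surj (p : R) : 0 < p < 1 -> exists z, Phi z = p.
Proof.
move=> /andP[p0 p1].
have c1 := @cvg_prob_ley R _ _ gamma idfun (@measurable_id _ _ setT).
have c0 := @cvg_prob_leNy R _ _ gamma idfun (@measurable_id _ _ setT).
have E : (fun x => fine (gamma [set y | idfun y <= x])) = Phi.
  by apply/funext => x; congr (fine (gamma _)); apply/seteqP; split => y /=;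
    rewrite in_itv.
rewrite E in c1 c0.
have [a pa] : exists a, p < Phi a.
  have /cvgr_gt/(_ p p1) := c1; move=> /(@filter_ex _ _ _); apply.
have [b pb] : exists b, Phi b < p.
  have /cvgr_lt/(_ p p0) := c0; move=> /(@filter_ex _ _ _); apply.
have ba : b <= a.
  rewrite leNgt; apply/negP => /stdnormal_cdf_incr; lra.
have := @IVT _ Phi b a p ba.
have [|z _ zp] := @IVT _ Phi b a p ba (continuous_subspaceT continuous_stdnormal_cdf).
  by rewrite ge_min le_max (ltW pb) (ltW pa) orbT.
by exists z.
Qed.

End standard_normal.

(** * Normal quantiles and the Neyman-Pearson lemma *)

Section stdnormal_quantile.
Context {R : realType}.
Notation mu := (@lebesgue_measure R).
Notation phi := (@normal_pdf R 0 1).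
Notation gamma := (@normal_prob R 0 1).
Notation Phi := (@stdnormal_cdf R).

Lemma stdnormal_cdf_le (x y : R) : (Phi x <= Phi y) = (x <= y).
Proof. by apply: le_mono; exact: stdnormal_cdf_incr. Qed.

Lemma stdnormal_prob_location_scale (m s x : R) : 0 <= s ->
  gamma [set z | m + s * z <= x] =
    if s == 0 then (m <= x)%R%:R%:E else (Phi ((x - m) / s))%:E.
Proof.
move=> s0; have [->|sn0] := eqVneq s 0.
  under eq_set do rewrite mul0r addr0.
  case: (m <= x).
    rewrite (_ : [set _ | _] = setT); first exact: probability_setT.
    by apply/seteqP; split.
  by rewrite (_ : [set _ | _] = set0) ?measure0//; apply/seteqP; split.
have sgt0 : 0 < s by rewrite lt_neqAle eq_sym sn0.
rewrite EFin_stdnormal_cdf; congr (gamma _); apply/seteqP; split => z /=;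
  by rewrite in_itv/= ler_pdivlMr// lerBrDl (mulrC z).
Qed.

Lemma inf_itvcy (a : R) : inf [set x | a <= x] = a.
Proof.
have ne : [set x | a <= x] !=set0 by exists a => /=.
apply/eqP; rewrite eq_le; apply/andP; split.
  by apply: ge_inf => //=; exists a.
by apply: lb_le_inf.
Qed.

(** With the level written [Phi z], the set that defines the quantile is the half-line from
    [m + s * z]. This includes the point mass [s = 0], which occurs when [domega = 0]: there a level
    strictly between 0 and 1 selects the half-line from [m]. *)
Lemma quantile_location_scale d (S : measurableType d) (Q : probability S R)
    (X : S -> R) (m s z : R) : 0 <= s -> 0 < Phi z < 1 ->
  (forall x, Q [set y | X y <= x] = gamma [set z | m + s * z <= x]) ->
  quantile Q X (Phi z) = m + s * z.
Proof.
move=> s0 /andP[p0 p1] h; rewrite /quantile -[RHS]inf_itvcy; congr inf.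
apply/seteqP; split => x /=; rewrite h stdnormal_prob_location_scale//;
  have [s0'|sn0] := eqVneq s 0.
- rewrite s0' mul0r addr0 lee_fin; case: (m <= x) => //; rewrite leNgt p0//.
- rewrite lee_fin stdnormal_cdf_le ler_pdivlMr; last by rewrite lt_neqAle eq_sym sn0.
  by rewrite lerBrDl mulrC.
- by rewrite s0' mul0r addr0 lee_fin => ->; exact: ltW.
- rewrite lee_fin stdnormal_cdf_le ler_pdivlMr; last by rewrite lt_neqAle eq_sym sn0.
  by rewrite lerBrDl mulrC.
Qed.

Lemma stdnormal_cdf_gt0 (z : R) : 0 < Phi z.
Proof.
have zz : z - 1 < z by lra.
by rewrite (le_lt_trans _ (stdnormal_cdf_incr zz))// fine_ge0.
Qed.

Lemma stdnormal_cdf_lt1 (z : R) : Phi z < 1.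
Proof.
have zz : z < z + 1 by lra.
rewrite (lt_le_trans (stdnormal_cdf_incr zz))// -lee_fin EFin_stdnormal_cdf.
exact: probability_le1.
Qed.

Lemma stdnormal_cdfK (z : R) : stdnormal_quantile (Phi z) = z.
Proof.
rewrite /stdnormal_quantile (@quantile_location_scale _ _ gamma idfun 0 1)//.
- by rewrite add0r mul1r.
- by rewrite stdnormal_cdf_gt0 stdnormal_cdf_lt1.
- by move=> x; under [in RHS]eq_set do rewrite add0r mul1r.
Qed.

Lemma stdnormal_quantileK (p : R) : 0 < p < 1 -> Phi (stdnormal_quantile p) = p.
Proof. by move=> /stdnormal_cdf_surj[z <-]; rewrite stdnormal_cdfK. Qed.

Lemma stdnormal_cdfN (z : R) : Phi (- z) = 1 - Phi z.
Proof.
apply: EFin_inj; rewrite -stdnormal_ccdf opprK EFinB EFin_stdnormal_cdf.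
have oc : gamma `]z, +oo[ = gamma `[z, +oo[.
  apply: integral_itv_obnd_cbnd.
  by apply/measurable_EFinP/measurable_funTS; exact: measurable_normal_pdf.
by rewrite -oc -setCitvl; exact: (@probability_setC _ _ _ gamma).
Qed.

Lemma stdnormal_prob_shift (tau : R) (B : set R) : measurable B ->
  gamma [set x | B (x + tau)] = (\int[mu]_(x in B) (phi (x - tau))%:E)%E.
Proof.
move=> mB; pose s (x : measurableTypeR R) : measurableTypeR R := x + tau.
have ms : measurable_fun setT s by exact: measurable_funD.
rewrite /normal_prob.
transitivity (\int[mu]_(x in s @^-1` B) (((fun x => (phi (x - tau))%:E) \o s) x))%E.
  by apply: eq_integral => x _ /=; rewrite /s addrK.
rewrite -(@ge0_integral_pushforward _ _ _ _ _ _ ms)//.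
- by apply: eq_measure_integral => A mA _; exact: lebesgue_measure_shift.
- apply/measurable_EFinP/measurable_funTS; apply: measurableT_comp.
    exact: measurable_normal_pdf.
  exact: measurable_funB.
- by move=> x _; rewrite lee_fin normal_pdf_ge0.
Qed.

Lemma stdnormal_pdf_shift (tau x : R) :
  phi (x - tau) = expR (tau * x - tau ^+ 2 / 2) * phi x.
Proof.
rewrite !stdnormal_pdfE mulrCA -expRD; congr (_ * expR _); by field.
Qed.

(* [k], the likelihood ratio at the threshold [z], is the Lagrange multiplier of
   the Neyman-Pearson problem of N(0, 1) against N(tau, 1). *)
Lemma stdnormal_neyman_pearson (tau z : R) (B : set R)
    (k := expR (tau * z - tau ^+ 2 / 2)) : 0 <= tau -> measurable B ->
  (gamma [set x | B (x + tau)%R] + k%:E * gamma `[z, +oo[ <=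
   k%:E * gamma B + gamma [set x | `[z, +oo[%classic (x + tau)%R])%E.
Proof.
move=> tau0 mB; pose C : set R := `[z, +oo[%classic.
have mC : measurable C by exact: measurable_itv.
have mphi : measurable_fun setT (fun x : R => (phi x)%:E).
  by apply/measurable_EFinP; exact: measurable_normal_pdf.
have mphit : measurable_fun setT (fun x : R => (phi (x - tau))%:E).
  apply/measurable_EFinP; apply: measurableT_comp; first exact: measurable_normal_pdf.
  exact: measurable_funB.
have p0 x : (0 <= (phi x)%:E)%E by rewrite lee_fin normal_pdf_ge0.
rewrite (stdnormal_prob_shift tau mB) (stdnormal_prob_shift tau mC) /normal_prob.
rewrite -/C.
rewrite -!ge0_integralZl//; try exact: measurable_funTS; try by rewrite lee_fin expR_ge0.
rewrite [X in (X + _ <= _)%E]integral_mkcond [X in (_ + X <= _)%E]integral_mkcond.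
rewrite [X in (_ <= X + _)%E]integral_mkcond [X in (_ <= _ + X)%E]integral_mkcond.
have k0 : (0 <= k%:E)%E by rewrite lee_fin expR_ge0.
have pp (D : set R) (f : R -> \bar R) : (forall x, 0 <= f x)%E ->
    forall x, (0 <= (f \_ D) x)%E.
  by move=> f0 x; rewrite patchE; case: ifP.
have mp (D : set R) (f : R -> \bar R) : measurable D -> measurable_fun setT f ->
    measurable_fun setT (f \_ D).
  by move=> mD mf; apply/(measurable_restrictT _ mD); exact: measurable_funTS.
have mk : measurable_fun setT (fun x : R => k%:E * (phi x)%:E)%E.
  exact: measurable_funeM.
rewrite -!ge0_integralD//; try by [move=> *; apply: pp => *; rewrite ?mule_ge0|exact: mp].
apply: ge0_le_integral => //.
- by move=> x _; rewrite adde_ge0// pp// => y; rewrite mule_ge0.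
- by apply: emeasurable_funD; exact: mp.
- by apply: emeasurable_funD; exact: mp.
(* On [C] the shifted density is at least [k * phi x], and off [C] at most that; so [C] is the best
   set point by point. The inequality is kept in additive form, free of subtractions in the extended
   reals. *)
move=> x _; rewrite !patchE; have : (x \in C) = (z <= x).
  by apply/idP/idP; rewrite inE /C/= in_itv/= andbT.
move=> ->; rewrite -!EFinM stdnormal_pdf_shift.
have phi0 : 0 <= phi x by exact: normal_pdf_ge0.
case: (x \in B); have [zx|xz] := leP z x; rewrite ?adde0 ?add0e ?lexx// ?lee_fin.
- by rewrite addrC.
- by rewrite ler_wpM2r// ler_expR lerD2r ler_wpM2l// ltW.
- by rewrite ler_wpM2r// ler_expR lerD2r ler_wpM2l.
Qed.

(** The sections of [A] have uncontrolled sizes, and only their average is at most [alpha]. The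
    inequality of [stdnormal_neyman_pearson] is linear in the section and its multiplier [k] is the
    same for all of them, so it can be integrated; the bound on the size of [A] is used only
    afterwards, through [0 <= k]. *)
Lemma product_neyman_pearson d (T : measurableType d) (P : probability T R)
    (tau alpha : R) (A : set (T * R)) : 0 <= tau -> 0 < alpha < 1 ->
  measurable A -> ((P \x gamma) A <= alpha%:E)%E ->
  ((P \x gamma) [set w | A (w.1, w.2 + tau)%R] <=
   (Phi (tau - stdnormal_quantile (1 - alpha)))%:E)%E.
Proof.
move=> tau0 /andP[a0 a1] mA hA.
set z := stdnormal_quantile _; pose k := expR (tau * z - tau ^+ 2 / 2).
have zE : Phi z = 1 - alpha by rewrite stdnormal_quantileK//; lra.
have gz : gamma `[z, +oo[ = alpha%:E.
  by rewrite -[z]opprK stdnormal_ccdf stdnormal_cdfN zE; congr (_%:E); lra.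
have gzt : gamma [set x | `[z, +oo[%classic (x + tau)] = (Phi (tau - z))%:E.
  rewrite -stdnormal_ccdf; congr (gamma _); apply/seteqP; split => x /=;
  by rewrite !in_itv/= !andbT opprB lerBlDr.
pose At : set (T * R) := [set w | A (w.1, w.2 + tau)].
have mshift : measurable_fun setT (fun w : T * R => (w.1, w.2 + tau)).
  apply/measurable_fun_pairP; split => /=; first exact: measurable_fst.
  by apply: measurable_funD => //; exact: measurable_snd.
have mAt : measurable At by rewrite -[At]setTI; exact: mshift.
have k0 : 0 < k by exact: expR_gt0.
have mxA : measurable_fun setT (gamma \o xsection A) by exact: measurable_fun_xsection.
have mxAt : measurable_fun setT (gamma \o xsection At) by exact: measurable_fun_xsection.
have cstE (c : R) : (\int[P]_w c%:E = c%:E)%E.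
  by rewrite integral_cst//= (@probability_setT _ _ _ P) mule1.
have : ((P \x gamma) At + k%:E * alpha%:E <=
    k%:E * (P \x gamma) A + (Phi (tau - z))%:E)%E.
  rewrite /product_measure1 -ge0_integralZl//; last by rewrite lee_fin ltW.
  rewrite -EFinM -(cstE (k * alpha)) -(cstE (Phi (tau - z))).
  have ka0 : 0 <= k * alpha by rewrite mulr_ge0 ?ltW.
  have P0 : 0 <= Phi (tau - z) by exact/ltW/stdnormal_cdf_gt0.
  rewrite -!ge0_integralD//; last 2 first.
  - by move=> w _; rewrite mule_ge0// lee_fin ltW.
  - exact: measurable_funeM.
  apply: ge0_le_integral => //.
  - by move=> w _; rewrite adde_ge0.
  - exact: emeasurable_funD.
  - by apply: emeasurable_funD => //; exact: measurable_funeM.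
  move=> w _; have mB : measurable (xsection A w) by exact: measurable_xsection.
  have E : xsection At w = [set x | xsection A w (x + tau)].
    by apply/seteqP; split => x; rewrite /xsection /= !inE.
  by have := stdnormal_neyman_pearson z tau0 mB; rewrite gz gzt -EFinM -E.
have kE0 : (0 <= k%:E)%E by rewrite lee_fin ltW.
move=> h; have := le_trans h (leeD2r _ (lee_wpmul2l kE0 hA)).
by rewrite addeC leeD2lE.
Qed.

End stdnormal_quantile.

(** * White noise *)

Section hilbert_product.
Context {R : realType} {Y : completeNormedModType R}.
Variable ip : {dot Y for (@idfun R)}.
Hypothesis hip : is_hilbert_product ip.

Lemma ipC u v : ip u v = ip v u.
Proof. by rewrite hermC/= expr0 mul1r. Qed.

Lemma ipDl u v w : ip (u + v) w = ip u w + ip v w.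
Proof. exact: linearDl. Qed.

Lemma ipZl a u w : ip (a *: u) w = a * ip u w.
Proof. exact: linearZl_LR. Qed.

Lemma ipBl u v w : ip (u - v) w = ip u w - ip v w.
Proof. exact: linearBl. Qed.

Lemma ipDr u v w : ip w (u + v) = ip w u + ip w v.
Proof. by rewrite ipC ipDl !(ipC w). Qed.

Lemma ipZr a u w : ip w (a *: u) = a * ip w u.
Proof. by rewrite ipC ipZl (ipC w). Qed.

Lemma ipBr u v w : ip w (u - v) = ip w u - ip w v.
Proof. by rewrite ipC ipBl !(ipC w). Qed.

Lemma ip0r w : ip w 0 = 0.
Proof. by rewrite -(scale0r 0) ipZr mul0r. Qed.

Lemma ip_sum u (s : seq (R * Y)) :
  ip u (\sum_(p <- s) p.1 *: p.2) = \sum_(p <- s) p.1 * ip u p.2.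
Proof.
elim: s => [|p s ih]; first by rewrite !big_nil ip0r.
by rewrite !big_cons ipDr ipZr ih.
Qed.

Lemma norm_projection (e h : Y) : `|e| = 1 ->
  `|h| ^+ 2 = ip e h ^+ 2 + `|h - ip e h *: e| ^+ 2.
Proof.
move=> e1; rewrite -!hip !(ipBl, ipBr, ipZl, ipZr) (ipC h e) (hip e) e1; ring.
Qed.

End hilbert_product.

Section noise.
Context {R : realType} {Y : completeNormedModType R}.
Context {dT} {T : measurableType dT} {P : probability T R}.
Variable eps : Y -> {RV P >-> R}.
Hypothesis heps : standard_gaussian_noise eps.
Notation gamma := (@normal_prob R 0 1).

Lemma noise0 : {ae P, forall w, eps 0 w = 0}.
Proof.
have := heps.1 1 0 0; apply: filterS => w.
rewrite scaler0 addr0 mul1r => /eqP.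
by rewrite -subr_eq0 opprD addrA subrr sub0r oppr_eq0 => /eqP.
Qed.

Lemma noiseZ (a : R) (h : Y) : {ae P, forall w, eps (a *: h) w = a * eps h w}.
Proof.
apply: filterS2 noise0 (heps.1 a h 0) => w e0.
by rewrite addr0 e0 addr0.
Qed.

(** Linearity holds off a null set that depends on the vectors; a test function involves finitely
    many of them, so finite sums suffice. *)
Lemma noise_sum (s : seq (R * Y)) : {ae P, forall w,
  eps (\sum_(p <- s) p.1 *: p.2) w = \sum_(p <- s) p.1 * eps p.2 w}.
Proof.
elim: s => [|p s ih].
  by apply: filterS noise0 => w; rewrite !big_nil.
apply: filterS2 ih (heps.1 p.1 p.2 (\sum_(p <- s) p.1 *: p.2)) => w.
by rewrite !big_cons => <- ->.
Qed.

Lemma ae_eq_prob (A B : set T) : measurable A -> measurable B ->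
  {ae P, forall w, A w <-> B w} -> P A = P B.
Proof.
move=> mA mB AB; rewrite -(setIT A) -(setIT B) -!integral_indic//.
apply: ae_eq_integral => //; try exact/measurable_EFinP.
apply: filterS AB => w AB _; congr (_%:E); rewrite !indicE.
by congr ((nat_of_bool _)%:R); apply/idP/idP; rewrite !inE; case: AB.
Qed.

(** Writing the law as an image of [gamma] under scaling gives one formula for all [h], zero
    included. A nonzero [h] is a multiple of a unit vector, where the standard deviation is 1. *)
Lemma noise_prob (h : Y) (A : set R) : measurable A ->
  P (eps h @^-1` A) = gamma [set x | A (`|h| * x)].
Proof.
move=> mA; have [->|h0] := eqVneq h 0.
  have := heps.2 0 _ mA; rewrite /gaussian normr0 eqxx /distribution /pushforward => ->.
  under [in RHS]eq_set do rewrite mul0r.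
  rewrite diracE; have [A0|A0] := boolP (0 \in A).
    rewrite (_ : [set _ | _] = setT) ?(@probability_setT _ _ _ gamma)//.
    by apply/seteqP; split => // x _; exact: set_mem.
  by rewrite (_ : [set _ | _] = set0) ?measure0//; apply/seteqP; split => // x /=;
    move/mem_set; rewrite (negbTE A0).
have n0 : `|h| != 0 by rewrite normr_eq0.
pose e := `|h|^-1 *: h.
have e1 : `|e| = 1 by rewrite normrZ normfV normr_id mulVf.
have mA' : measurable [set x | A (`|h| * x)].
  by rewrite -[X in measurable X]setTI; apply: (@measurable_funM _ _ _ setT).
have := heps.2 e _ mA'; rewrite /gaussian e1 oner_eq0 => <-.
rewrite /distribution /pushforward; apply: ae_eq_prob.
- by rewrite -[X in measurable X]setTI; exact: measurable_funP.
- by rewrite -[X in measurable X]setTI; exact: measurable_funP.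
- apply: filterS (noiseZ `|h| e) => w.
  by rewrite scalerA divff// scale1r /= => ->.
Qed.

Lemma noise_integral (h : Y) (f : R -> R) : measurable_fun setT f ->
  gamma.-integrable setT (fun x => (f (`|h| * x))%:E) ->
  P.-integrable setT (fun w => (f (eps h w))%:E) /\
  (\int[P]_w (f (eps h w))%:E = \int[gamma]_x (f (`|h| * x)%R)%:E)%E.
Proof.
move=> mf fi.
pose s (x : R) : R := `|h| * x.
have ms : measurable_fun setT s by exact: measurable_funM.
have E (g : R -> \bar R) :
    (\int[distribution P (eps h)]_x g x = \int[pushforward gamma s]_x g x)%E.
  by apply: (@eq_measure_integral _ _ _ setT
    [the measure _ _ of pushforward gamma s] (distribution P (eps h))) => A mA _;
    exact: noise_prob.
have i : P.-integrable setT (fun w => (f (eps h w))%:E).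
  apply/integrableP; split.
    by apply/measurable_EFinP; exact: measurableT_comp.
  case/integrableP : fi => _; apply: le_lt_trans.
  rewrite le_eqVlt; apply/orP; left; apply/eqP.
  transitivity (\int[pushforward gamma s]_x `|(f x)%:E|)%E; last first.
    rewrite ge0_integral_pushforward//.
    by apply: measurableT_comp => //; exact/measurable_EFinP.
  rewrite -E ge0_integral_distribution//.
  by apply: measurableT_comp => //; exact/measurable_EFinP.
split=> //; transitivity (\int[pushforward gamma s]_x (f x)%:E)%E.
  by rewrite -E integral_distribution//; exact/measurable_EFinP.
by rewrite integral_pushforward//; exact/measurable_EFinP.
Qed.

Lemma noise_mean (h : Y) : P.-integrable setT (fun w => (eps h w)%:E) /\
  (\int[P]_w (eps h w)%:E = 0)%E.
Proof.
have i : gamma.-integrable setT (fun x : R => (`|h| * x)%:E).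
  have := integrableZl measurableT `|h| (@integrable_stdnormal_id R).
  by congr (_ .-integrable _ _); apply/funext => x /=; rewrite EFinM.
have [-> // ->] := @noise_integral h id (@measurable_id _ _ setT) i; split => //.
under eq_integral do rewrite EFinM.
rewrite integralZl//; last exact: integrable_stdnormal_id.
by rewrite integral_stdnormal_id mule0.
Qed.

Lemma stdnormal_cos (th t : R) :
  \int[gamma]_x cos (th + t * x) = cos th * expR (- (t ^+ 2 / 2)).
Proof.
have ic : gamma.-integrable setT (EFin \o fun x : R => cos (t * x)).
  by apply: bounded_stdnormal_integrable => [|x]; [exact: measurable_cosM|exact: cos_max].
have is_ : gamma.-integrable setT (EFin \o fun x : R => sin (t * x)).
  by apply: bounded_stdnormal_integrable => [|x]; [exact: measurable_sinM|exact: sin_max].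
have h (c : R) (f : R -> R) : gamma.-integrable setT (EFin \o f) ->
    gamma.-integrable setT (EFin \o fun x : R => c * f x).
  move=> /(integrableZl measurableT c).
  by congr (_ .-integrable _ _); apply/funext => x /=; rewrite EFinM.
under eq_Rintegral do rewrite cosD.
rewrite RintegralB//; [|exact: h..].
by rewrite !RintegralZl// stdnormal_sin mulr0 subr0 -stdnormal_cfE.
Qed.

Lemma noise_cos (th : R) (h : Y) :
  \int[P]_w cos (th + eps h w) = cos th * expR (- (`|h| ^+ 2 / 2)).
Proof.
have mc : measurable_fun setT (fun x : R => cos (th + x)).
  apply: measurable_fun_cos.
  exact: measurable_funD.
have mg : measurable_fun setT (fun x : R => cos (th + `|h| * x)).
  by apply: (measurableT_comp mc); exact: measurable_funM.
have [_] := noise_integral mc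
  (bounded_stdnormal_integrable mg (fun x => cos_max _)).
by rewrite -stdnormal_cos /Rintegral => ->.
Qed.

End noise.

(** * Splitting the data along a direction *)

Section split_observation.
Context {R : realType} {Y : completeNormedModType R} {V : lmodType R}.
Context {dT} {T : measurableType dT} {P : probability T R}.
Variable ip : {dot Y for (@idfun R)}.
Hypothesis hip : is_hilbert_product ip.
Variables (K : {linear V -> Y}) (sigma : R) (eps : Y -> {RV P >-> R}).
Hypothesis heps : standard_gaussian_noise eps.
Notation gamma := (@normal_prob R 0 1).

(* The noise is split along the unit vector [e]: its component along [e] becomes
   an independent standard normal variable. *)
Definition split_data (e : Y) (f : V) (w : T * measurableTypeR R) : sample_space Y :=
  fun h => ip (K f) h + sigma * (ip e h * w.2 + eps (h - ip e h *: e) w.1).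

Lemma measurable_split_data e f : measurable_fun setT (split_data e f).
Proof.
apply: (@measurability _ _ _ (sample_space Y) setT (split_data e f)
  (@cylinder R Y) erefl).
move=> _ [_ [h [B [mB ->]]] <-].
have mh : measurable_fun setT (fun w : T * measurableTypeR R =>
    ip (K f) h + sigma * (ip e h * w.2 + eps (h - ip e h *: e) w.1)).
  apply: measurable_funD => //; apply: measurable_funM => //.
  apply: measurable_funD; first by apply: measurable_funM => //; exact: measurable_snd.
  by apply: measurableT_comp => //; exact: measurable_fst.
exact: (mh measurableT B mB).
Qed.

Lemma measurable_coordinate (h : Y) :
  measurable_fun setT (fun y : sample_space Y => y h).
Proof.
move=> _ B mB; rewrite setTI; apply: sub_sigma_algebra.
by exists h, B.
Qed.

(** A combination of coordinates of the data is almost surely the pairing with one vector [H], so a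
    single marginal of the noise gives the integral. *)
Lemma data_trig (f : V) (s : seq (R * Y)) (th : R) :
  \int[data_law ip K sigma eps f]_y trig (fun h (y : sample_space Y) => y h) s th y =
  cos (th + ip (K f) (\sum_(p <- s) p.1 *: p.2)) *
  expR (- (`|sigma *: \sum_(p <- s) p.1 *: p.2| ^+ 2 / 2)).
Proof.
set H := \sum_(p <- s) _.
rewrite -(noise_cos heps) /Rintegral; congr fine.
have mt := measurable_trig (@measurable_coordinate) s th.
rewrite integral_distribution//; first last.
- apply: (@measurable_bounded_integrable _ _ _ P) => //.
  + by rewrite -ge0_fin_numE// fin_num_measure.
  + apply: measurableT_comp => //; exact: measurable_data.
  + by exists 1; split=> // x x1 y _; rewrite /= (le_trans (cos_max _)) // ltW.
- exact/measurable_EFinP.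
apply: ae_eq_integral => //.
- apply/measurable_EFinP; apply: measurableT_comp => //; exact: measurable_data.
- apply/measurable_EFinP; apply: measurable_fun_cos.
  exact: measurable_funD.
apply: filterS2 (noise_sum heps s) (noiseZ heps sigma H) => w e1 e2 _ /=.
rewrite /trig; congr (cos _)%:E; rewrite e2 e1 ip_sum// -addrA; congr (th + _).
rewrite mulr_sumr -big_split/=; apply: eq_bigr => p _; rewrite /data; ring.
Qed.

(** By Fubini the normal coordinate contributes the squared length of the component of [sigma *: H]
    along [e], and the remainder that of the orthogonal component; Pythagoras adds them up. *)
Lemma split_data_trig (e : Y) (f : V) (s : seq (R * Y)) (th : R) : `|e| = 1 ->
  \int[(P \x gamma)%E]_w
    trig (fun h (y : sample_space Y) => y h) s th (split_data e f w) =
  cos (th + ip (K f) (\sum_(p <- s) p.1 *: p.2)) *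
  expR (- (`|sigma *: \sum_(p <- s) p.1 *: p.2| ^+ 2 / 2)).
Proof.
move=> e1; set H := \sum_(p <- s) _; pose t := sigma * ip e H.
pose th' w := th + ip (K f) H + sigma * \sum_(p <- s) p.1 * eps (p.2 - ip e p.2 *: e) w.
pose Q : probability (T * measurableTypeR R)%type R := (P \x gamma)%E.
have mt := measurable_trig (@measurable_coordinate) s th.
have mts : measurable_fun setT
    (fun w => (trig (fun h (y : sample_space Y) => y h) s th (split_data e f w))%:E).
  apply/measurable_EFinP; apply: (measurableT_comp mt); exact: measurable_split_data.
have E (w : T) (x : R) :
    trig (fun h (y : sample_space Y) => y h) s th (split_data e f (w, x)) =
    cos (th' w + t * x).
  rewrite /trig /th' /t !ip_sum; congr cos.
  rewrite !mulr_sumr mulr_suml -!addrA; congr (th + _).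
  by rewrite -!big_split/=; apply: eq_bigr => p _; rewrite /split_data/=; ring.
transitivity (\int[P]_w (cos (th' w) * expR (- (t ^+ 2 / 2)))).
  rewrite /Rintegral; congr fine.
  rewrite -integral12_prod_meas1; last first.
    apply: (@measurable_bounded_integrable _ _ _ (P \x gamma)%E) => //.
    - rewrite -ge0_fin_numE//; exact: (@fin_num_measure _ _ _ Q).
    - exact/measurable_EFinP.
    - by exists 1; split=> // x x1 y _; rewrite /= (le_trans (cos_max _)) // ltW.
  apply: eq_integral => w _; rewrite -stdnormal_cos /fubini_F.
  rewrite /Rintegral fineK; last first.
    apply: integrable_fin_num => //.
    apply: (@bounded_stdnormal_integrable _ (fun x => cos (th' w + t * x))) => [|x].
      apply: measurable_fun_cos.
      by apply: measurable_funD => //; exact: measurable_funM.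
    exact: cos_max.
  by apply: eq_integral => x _; rewrite E.
have mth' : measurable_fun setT (fun w => cos (th' w)).
  apply: measurable_fun_cos.
  apply: measurable_funD => //; apply: measurable_funM => //.
  by apply: measurable_sum => p; apply: measurable_funM.
have i1 : P.-integrable setT (EFin \o fun w => cos (th' w)).
  apply: (@measurable_bounded_integrable _ _ _ P) => //.
  - by rewrite -ge0_fin_numE// fin_num_measure.
  - by exists 1; split=> // x x1 y _; rewrite /= (le_trans (cos_max _)) // ltW.
rewrite RintegralZr//.
pose H' := H - ip e H *: e.
transitivity ((\int[P]_w cos (th + ip (K f) H + eps (sigma *: H') w)) *
    expR (- (t ^+ 2 / 2))).
  congr (_ * _); rewrite /Rintegral; congr fine; apply: ae_eq_integral => //.
  - exact/measurable_EFinP.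
  - apply/measurable_EFinP; apply: measurable_fun_cos.
    exact: measurable_funD.
  pose s' := [seq (p.1, p.2 - ip e p.2 *: e) | p <- s].
  have HE : \sum_(p <- s') p.1 *: p.2 = H'.
    rewrite big_map /H' /H ip_sum scaler_suml -sumrB.
    by apply: eq_bigr => p _; rewrite /= scalerBr scalerA.
  apply: filterS2 (noise_sum heps s') (noiseZ heps sigma H') => w a1 a2 _ /=.
  by rewrite a2 -HE a1 big_map.
rewrite (noise_cos heps) -mulrA -expRD; congr (_ * expR _).
have := norm_projection hip H e1; rewrite -/H' => hH.
rewrite !normrZ !exprMn !real_normK ?num_real// hH /t; ring.
Qed.

(** Independence is never proved on [T]: the split process has it by construction on a product
    space, and equal trigonometric integrals identify its law with that of the data. *)
Lemma data_law_split (e : Y) (f : V) (A : set (sample_space Y)) : `|e| = 1 ->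
  measurable A ->
  data_law ip K sigma eps f A = ((P \x gamma) (split_data e f @^-1` A))%E.
Proof.
move=> e1 mA.
pose psi : {mfun (T * measurableTypeR R)%type >-> sample_space Y} :=
  HB.pack (split_data e f) (isMeasurableFun.Build _ _ _ _ _ (measurable_split_data e f)).
pose Q : probability (T * measurableTypeR R)%type R := (P \x gamma)%E.
apply: (@trig_uniqueness R _ (sample_space Y) (data_law ip K sigma eps f)
  (distribution Q psi) Y (fun h y => y h) (@measurable_coordinate)) => //.
move=> s th; rewrite data_trig -(split_data_trig f s th e1).
have mt := measurable_trig (@measurable_coordinate) s th.
rewrite /Rintegral integral_distribution//.
  exact/measurable_EFinP.
apply: (@measurable_bounded_integrable _ _ _ Q) => //.
- by rewrite -ge0_fin_numE//; exact: (@fin_num_measure _ _ _ Q).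
- by apply: (measurableT_comp mt); exact: measurable_split_data.
- by exists 1; split=> // x x1 y _; rewrite /= (le_trans (cos_max _)) // ltW.
Qed.

(** [K g - K f] is a multiple of [e], so passing from [f] to [g] merely translates the normal
    coordinate by [|u| / sigma] and leaves the remainder unchanged. *)
Lemma data_law_neyman_pearson (alpha : R) (f g : V) (A : set (sample_space Y)) :
  0 < sigma -> 0 < alpha < 1 -> K f != K g -> measurable A ->
  (data_law ip K sigma eps f A <= alpha%:E)%E ->
  (data_law ip K sigma eps g A <= (stdnormal_cdf
     (`|K (g - f)| / sigma - stdnormal_quantile (1 - alpha)))%:E)%E.
Proof.
move=> s0 a01 Kfg mA; set u := K (g - f).
have n0 : `|u| != 0 by rewrite normr_eq0 /u linearB subr_eq0 eq_sym.
pose e := `|u|^-1 *: u.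
have e1 : `|e| = 1 by rewrite normrZ normfV normr_id mulVf.
rewrite !(data_law_split _ e1 mA) => fA.
have mfA : measurable (split_data e f @^-1` A).
  by rewrite -[X in measurable X]setTI; exact: measurable_split_data.
have tau0 : 0 <= `|u| / sigma by rewrite divr_ge0// ltW.
have E : split_data e g @^-1` A =
    [set w | (split_data e f @^-1` A) (w.1, w.2 + `|u| / sigma)].
  apply/funext => w; rewrite /preimage /mkset; congr A.
  apply/funext => h; rewrite /split_data/=.
  have -> : K g = K f + u by rewrite /u linearB addrC subrK.
  rewrite ipDl (_ : ip u h = `|u| * ip e h); last by rewrite ipZl mulrA divff ?mul1r.
  by field; rewrite gt_eqF.
rewrite E; exact: product_neyman_pearson.
Qed.

End split_observation.

(** * The modulus of continuity and its tangents *)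

Lemma convex_set_segment {R : realType} {V : lmodType R} (A : set V) (x y : V)
    (t : R) : convex_set A -> A x -> A y -> 0 <= t <= 1 -> A (x + t *: (y - x)).
Proof.
move=> cA Ax Ay /andP[t0 t1].
have -> : x + t *: (y - x) = t *: y + (1 - t) *: x.
  by rewrite scalerBr scalerBl scale1r addrCA.
by have := cA y x (Itv01 t0 t1) (mem_set Ay) (mem_set Ax); rewrite inE.
Qed.

(** Lets [t] tend to 0; it discards the second-order term of expansions along a segment. *)
Lemma ler_limit0 {R : realFieldType} (a b c : R) :
  (forall t, 0 < t -> t <= 1 -> a <= b + t * c) -> a <= b.
Proof.
move=> h; rewrite leNgt; apply/negP => ba.
pose n := `|c| + 1; have n0 : 0 < n by rewrite ltr_wpDl.
pose t := Num.min 1 ((a - b) / (2 * n)).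
have t0 : 0 < t by rewrite lt_min ltr01 divr_gt0 ?subr_gt0 ?mulr_gt0.
have t1 : t <= 1 by rewrite ge_min lexx.
have tc : t * c <= (a - b) / 2.
  have -> : (a - b) / 2 = (a - b) / (2 * n) * n by field; rewrite gt_eqF.
  apply: (@le_trans _ _ (t * n)).
    rewrite ler_wpM2l ?(ltW t0)// /n; have := ler_norm c; lra.
  by rewrite ler_wpM2r ?(ltW n0)// ge_min lexx orbT.
by have := h t t0 t1; lra.
Qed.

Section modulus_tangent.
Context {R : realType} {V : lmodType R} {Y : completeNormedModType R}.
Variable ip : {dot Y for (@idfun R)}.
Hypothesis hip : is_hilbert_product ip.
Variables (K : {linear V -> Y}) (L : {scalar V}) (F G : set V).
Variables (delta domega : R) (fs gs : V).
Hypotheses (hF : convex_set F) (hG : convex_set G) (hdelta : 0 < delta).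
Hypothesis hdomega : superdifferential K L F G delta domega.
Hypotheses (hfs : F fs) (hgs : G gs).
Hypothesis hmod : (L gs - L fs)%:E = modulus K L F G delta.
Hypothesis hdist : `|K (fs - gs)| = delta.

Let h := K (gs - fs).

Lemma modulus_ub f g eta : F f -> G g -> `|K (g - f)| <= eta ->
  ((L g - L f)%:E <= modulus K L F G eta)%E.
Proof. by move=> Ff Gg fg; apply: ereal_sup_ubound; exists f, g. Qed.

Lemma norm_modulus_direction : `|h| = delta.
Proof. by rewrite -hdist /h -opprB linearN normrN. Qed.

(** The pair [(fs, gs)] stays admissible at radius [delta + 1], so the modulus does not decrease
    there. *)
Lemma superdifferential_ge0 : 0 <= domega.
Proof.
have d1 : 0 < delta + 1 by rewrite addr_gt0.
have hle : `|K (gs - fs)| <= delta + 1 by rewrite norm_modulus_direction lerDl.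
have := le_trans (modulus_ub hfs hgs hle) (hdomega d1).
have e : delta + 1 - delta = 1 by rewrite addrAC subrr add0r.
by rewrite -hmod -EFinD lee_fin e mulr1 lerDl.
Qed.

(* AM-GM: [delta * eta <= (delta^2 + eta^2) / 2] avoids the derivative of the
   norm, and any case analysis at [K (g - f) = 0]. *)
Lemma modulus_tangent f g : F f -> G g ->
  L g - L f <= L gs - L fs +
    domega * ((`|K (g - f)| ^+ 2 - delta ^+ 2) / (2 * delta)).
Proof.
move=> Ff Gg; pose eta := (delta ^+ 2 + `|K (g - f)| ^+ 2) / (2 * delta).
have dd : 0 < 2 * delta by rewrite mulr_gt0.
have eta0 : 0 < eta by rewrite divr_gt0// ltr_wpDr ?sqr_ge0// exprn_gt0.
have le_eta : `|K (g - f)| <= eta.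
  rewrite ler_pdivlMr//; have := sqr_ge0 (delta - `|K (g - f)|); nra.
have := le_trans (modulus_ub Ff Gg le_eta) (hdomega eta0).
rewrite -hmod -EFinD lee_fin => /le_trans; apply; rewrite lerD2l.
by rewrite (_ : _ - delta = (`|K (g - f)| ^+ 2 - delta ^+ 2) / (2 * delta))//
  /eta; field; rewrite gt_eqF.
Qed.

Let expand u v t : `|u - t *: v| ^+ 2 =
  `|u| ^+ 2 - 2 * t * ip u v + t ^+ 2 * `|v| ^+ 2.
Proof. by rewrite -!hip !(ipBl, ipBr, ipZl, ipZr) (ipC ip v u); ring. Qed.

(** The first-order optimality condition at [fs]: the quadratic bound is applied to
    [fs + t *: (f - fs)], divided by [t], and [t] tends to 0. *)
Lemma modulus_tangent_left f : F f ->
  domega / delta * ip h (K (f - fs)) <= L f - L fs.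
Proof.
move=> Ff; set v := K (f - fs).
apply: (@ler_limit0 _ _ _ (domega * (`|v| ^+ 2 / (2 * delta)))) => t t0 t1.
have t01 : 0 <= t <= 1 by rewrite ltW.
have := modulus_tangent (convex_set_segment hF hfs Ff t01) hgs.
have -> : K (gs - (fs + t *: (f - fs))) = h - t *: v.
  by rewrite opprD addrA linearB linearZ.
rewrite expand norm_modulus_direction linearD linearZ linearB/=.
set a := L f; set b := L fs; set c := ip h v; set n := `|v| ^+ 2 => w.
have : t * (domega / delta * c) <= t * (a - b + t * (domega * (n / (2 * delta)))).
  rewrite -subr_ge0.
  have -> : t * (a - b + t * (domega * (n / (2 * delta)))) - t * (domega / delta * c)
      = (L gs - b + domega *
          ((delta ^+ 2 - 2 * t * c + t ^+ 2 * n - delta ^+ 2) / (2 * delta)))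
        - (L gs - (b + t * (a - b))).
    by field; rewrite gt_eqF.
  by rewrite subr_ge0.
by rewrite ler_pM2l.
Qed.

Lemma modulus_tangent_right g : G g ->
  L g - L gs <= domega / delta * ip h (K (g - gs)).
Proof.
move=> Gg; set v := K (g - gs).
apply: (@ler_limit0 _ _ _ (domega * (`|v| ^+ 2 / (2 * delta)))) => t t0 t1.
have t01 : 0 <= t <= 1 by rewrite ltW.
have := modulus_tangent hfs (convex_set_segment hG hgs Gg t01).
have -> : K (gs + t *: (g - gs) - fs) = h - (- t) *: v.
  by rewrite addrAC linearD linearZ scaleNr opprK.
rewrite expand norm_modulus_direction linearD linearZ linearB/=.
set a := L g; set b := L gs; set c := ip h v; set n := `|v| ^+ 2 => w.
have : t * (a - b) <= t * (domega / delta * c + t * (domega * (n / (2 * delta)))).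
  rewrite -subr_ge0.
  have -> : t * (domega / delta * c + t * (domega * (n / (2 * delta)))) - t * (a - b)
      = (b - L fs + domega *
          ((delta ^+ 2 - 2 * - t * c + (- t) ^+ 2 * n - delta ^+ 2) / (2 * delta)))
        - (b + t * (a - b) - L fs).
    by field; rewrite gt_eqF.
  by rewrite subr_ge0.
by rewrite ler_pM2l.
Qed.

End modulus_tangent.

(** * Law of the affine estimator *)

Section affine_estimator.
Context {R : realType} {V : lmodType R} {Y : completeNormedModType R}.
Context {dT} {T : measurableType dT} {P : probability T R}.
Variable ip : {dot Y for (@idfun R)}.
Hypothesis hip : is_hilbert_product ip.
Variables (K : {linear V -> Y}) (L : {scalar V}) (eps : Y -> {RV P >-> R}).
Hypothesis heps : standard_gaussian_noise eps.
Variables (sigma delta domega : R) (fs gs : V).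
Hypotheses (hsigma : 0 < sigma) (hdelta : 0 < delta) (hdomega : 0 <= domega).
Hypothesis hdist : `|K (gs - fs)| = delta.
Notation gamma := (@normal_prob R 0 1).

Let h := K (gs - fs).
Let Pf := data_law ip K sigma eps.
Let Lh := Lhat K L ip delta domega fs gs.

Definition estimator_bias (f : V) : R :=
  L (midpoint fs gs) - L f + domega / delta * ip h (K (f - midpoint fs gs)).

Lemma Lhat_data f w : Lh (data ip K sigma eps f w) - L f =
  estimator_bias f + domega / delta * sigma * eps h w.
Proof.
rewrite /Lh /Lhat /data /estimator_bias -/h (ipC ip (K f)) linearB/= ipBr.
by ring.
Qed.

Lemma measurable_Lhat : measurable_fun setT Lh.
Proof.
apply: measurable_funD => //; apply: measurable_funM => //.
by apply: measurable_funB => //; exact: measurable_coordinate.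
Qed.

Lemma expectation_Lhat f : ('E_(Pf f)[(fun y => Lh y - L f)%R] = (estimator_bias f)%:E)%E.
Proof.
rewrite unlock.
have E w : (Lh (data ip K sigma eps f w) - L f)%:E =
    ((estimator_bias f)%:E + (domega / delta * sigma)%:E * (eps h w)%:E)%E.
  by rewrite Lhat_data EFinD EFinM.
have [ie me] := noise_mean heps h.
have ic : P.-integrable setT (fun=> (estimator_bias f)%:E).
  exact: finite_measure_integrable_cst.
have iz := integrableZl measurableT (domega / delta * sigma) ie.
rewrite integral_distribution/=; last 2 first.
- by apply/measurable_EFinP; apply: measurable_funB => //; exact: measurable_Lhat.
- by rewrite /comp; under eq_fun do rewrite E; exact: integrableD.
under eq_integral do rewrite E.
rewrite integralD// integralZl// me mule0 adde0 integral_cst//=.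
by rewrite (@probability_setT _ _ _ P) mule1.
Qed.

Lemma measurable_affine_le (m c x : R) : measurable [set t : R | m + c * t <= x].
Proof.
rewrite (_ : [set _ | _] = (fun t => m + c * t) @^-1` `]-oo, x]%classic); last first.
  by apply/funext => t; rewrite /preimage /mkset /= in_itv.
have mf : measurable_fun setT (fun t : R => m + c * t).
  by apply: measurable_funD => //; exact: measurable_funM.
by rewrite -[X in measurable X]setTI; apply: mf => //; exact: measurable_itv.
Qed.

Lemma noise_location_scale (m c x : R) :
  P [set w | m + c * eps h w <= x] = gamma [set t | m + c * delta * t <= x].
Proof.
have := noise_prob heps h (measurable_affine_le m c x).
rewrite /preimage /mkset /h hdist => ->; congr (gamma _).
by apply/funext => t; rewrite /mkset mulrA.
Qed.

Lemma estimator_bias_prob f (b x : R) :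
  Pf f [set y | Lh y - b <= x] =
  gamma [set t | estimator_bias f + L f - b + domega * sigma * t <= x].
Proof.
transitivity (P [set w |
    estimator_bias f + L f - b + domega / delta * sigma * eps h w <= x]).
  rewrite /Pf /data_law /distribution /pushforward; congr (P _).
  apply/funext => w; rewrite /preimage /mkset.
  by have := Lhat_data f w => /(canRL (subrK _)) ->; congr (is_true (_ <= _)); ring.
rewrite noise_location_scale; congr (gamma _); apply/funext => t; rewrite /mkset.
by congr (is_true (_ <= _)); field; rewrite gt_eqF.
Qed.

(** The noise enters the excess length with a minus sign; symmetry of the normal law removes it, so
    that the scale [domega * sigma] is nonnegative. *)
Lemma estimator_excess_prob g (b x : R) :
  Pf g [set y | L g - (Lh y - b) <= x] =
  gamma [set t | b - estimator_bias g + domega * sigma * t <= x].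
Proof.
transitivity (P [set w |
    b - estimator_bias g + (- (domega / delta * sigma)) * eps h w <= x]).
  rewrite /Pf /data_law /distribution /pushforward; congr (P _).
  apply/funext => w; rewrite /preimage /mkset.
  by have := Lhat_data g w => /(canRL (subrK _)) ->; congr (is_true (_ <= _)); ring.
rewrite noise_location_scale -stdnormal_probN; last exact: measurable_affine_le.
congr (gamma _); apply/funext => t; rewrite /preimage /mkset.
by congr (is_true (_ <= _)); field; rewrite gt_eqF.
Qed.

Let midpointxx (x : V) : 2^-1 *: (x + x) = x.
Proof. by rewrite -mulr2n -(scaler_nat 2 x) scalerA mulVf ?scale1r. Qed.

(** [fs] and [gs] lie at [-1/2] and [+1/2] times [gs - fs] from the midpoint, so the biases at the
    two are opposite. *)
Lemma estimator_bias_left :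
  estimator_bias fs = (L gs - L fs - domega * delta) / 2.
Proof.
have <- : domega / delta * ip h h = domega * delta.
  by rewrite hip /h hdist; field; rewrite gt_eqF.
rewrite /estimator_bias /midpoint linearZ linearD/=.
have -> : K (fs - 2^-1 *: (fs + gs)) = (- 2^-1) *: h.
  rewrite /h -linearZ; congr (K _).
  by rewrite -{1}(midpointxx fs) -scalerBr opprD addrACA subrr add0r
    scaleNr -scalerN opprB.
by rewrite ipZr; field; rewrite gt_eqF.
Qed.

Lemma estimator_bias_right :
  estimator_bias gs = - (L gs - L fs - domega * delta) / 2.
Proof.
have <- : domega / delta * ip h h = domega * delta.
  by rewrite hip /h hdist; field; rewrite gt_eqF.
rewrite /estimator_bias /midpoint linearZ linearD/=.
have -> : K (gs - 2^-1 *: (fs + gs)) = 2^-1 *: h.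
  rewrite /h -linearZ; congr (K _).
  by rewrite -{1}(midpointxx gs) -scalerBr opprD addrACA subrr addr0.
by rewrite ipZr; field; rewrite gt_eqF.
Qed.

Lemma estimator_biasB f g : estimator_bias f - estimator_bias g =
  L g - L f + domega / delta * ip h (K (f - g)).
Proof.
by rewrite /estimator_bias !linearB/=; ring.
Qed.

End affine_estimator.

(** A quantile at most [x] only yields power at least [beta], which the Neyman-Pearson bound for
    [fs] against [gs] would allow. The slack [om - x] is therefore spent on moving from [fs] towards
    [gs], which makes the bound on the power strictly smaller than [beta]. *)
Lemma excess_quantile_lower_bound (R : realType) (V : lmodType R)
    (Y : completeNormedModType R) (ip : {dot Y for (@idfun R)})
    (hip : is_hilbert_product ip) (K : {linear V -> Y}) (L : {scalar V})
    (dT : measure_display) (T : measurableType dT) (P : probability T R)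
    (eps : Y -> {RV P >-> R}) (heps : standard_gaussian_noise eps)
    (sigma alpha : R) (F : set V) (fs gs : V) (c : sample_space Y -> R) :
    0 < sigma -> 0 < alpha < 1 -> convex_set F -> F fs -> F gs ->
    K fs != K gs -> L fs <= L gs ->
    one_sided_CI (data_law ip K sigma eps) L F alpha c ->
  L gs - L fs <= excess_quantile (data_law ip K sigma eps) L c
    (stdnormal_cdf (`|K (gs - fs)| / sigma - stdnormal_quantile (1 - alpha))) gs.
Proof.
move=> s0 a01 hF hfs hgs Kfg Lfg [mc cov]; set Pf := data_law ip K sigma eps.
set om := L gs - L fs; set beta := stdnormal_cdf _.
have om0 : 0 <= om by rewrite subr_ge0.
have beta1 : beta < 1 by exact: stdnormal_cdf_lt1.
have mX : measurable_fun setT (fun y => L gs - c y) by exact: measurable_funB.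
have mle (X : sample_space Y -> R) (x : R) : measurable_fun setT X ->
    measurable [set y | X y <= x].
  move=> mX'; rewrite -[X in measurable X]setTI.
  rewrite (_ : [set _ | _] = X @^-1` `]-oo, x]%classic).
    by apply: mX' => //; exact: measurable_itv.
  by apply/funext => y; rewrite /preimage /mkset/= in_itv.
apply: lb_le_inf.
  (* The infimum of an empty set is a default value, so a point is exhibited: the distribution
     function eventually exceeds [beta < 1]. *)
  have /cvgr_gt/(_ _ beta1) := cvg_prob_ley (Pf gs) mX.
  move=> /(@filter_ex _ _ _)[x bx]; exists x => /=.
  by rewrite -[leRHS]fineK ?fin_num_measure// ?lee_fin ?ltW//; exact: mle.
move=> x /= hx; rewrite leNgt; apply/negP => xom.
(* If [L gs - c y <= x], then [c y >= L fs + a], which exceeds [L fl = L fs + l * om] as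
   [l * om < a]: the interval misses [L fl]. The [+ 1] keeps [l < 1] when [om = 0]. *)
pose a := om - x; pose l := a / (a + om + 1).
have a0 : 0 < a by rewrite subr_gt0.
have d0 : 0 < a + om + 1 by lra.
have l0 : 0 < l by rewrite divr_gt0.
have l1 : l < 1 by rewrite ltr_pdivrMr// mul1r; lra.
have lom : l * om < a.
  rewrite /l mulrAC ltr_pdivrMr//; nra.
pose fl := fs + l *: (gs - fs).
have Ffl : F fl by apply: convex_set_segment => //; rewrite !ltW.
have Lfl : L fl = L fs + l * om by rewrite /fl linearD linearZ linearB.
have Kfl : K (gs - fl) = (1 - l) *: K (gs - fs).
  by rewrite -linearZ; congr (K _); rewrite /fl opprD addrA scalerBl scale1r.
have u0 : K (gs - fs) != 0 by rewrite linearB subr_eq0 eq_sym.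
have Kne : K fl != K gs.
  by rewrite eq_sym -subr_eq0 -linearB Kfl scaler_eq0 (negbTE u0) orbF gt_eqF// subr_gt0.
have mB := mle _ x mX; set B := [set y | _] in mB hx.
have PB : (Pf fl B <= alpha%:E)%E.
  have mC : measurable [set y | c y <= L fl] by exact: mle.
  have hC : ((1 - alpha)%:E <= Pf fl [set y | (c y <= L fl)%R])%E.
    by apply: (le_trans cov); apply: ereal_inf_lbound; exists fl.
  apply: (@le_trans _ _ (Pf fl (~` [set y | (c y <= L fl)%R]))).
    apply: le_measure; rewrite ?inE//; first exact: measurableC.
    have Lgs : L gs = L fs + om by rewrite /om addrC subrK.
    have aE : a = om - x by [].
    move=> y; rewrite /B /setC /mkset => By; apply/negP; rewrite -ltNge Lfl.
    clearbody a l om; move: By; rewrite Lgs => By; lra.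
  rewrite probability_setC// leeBlDr ?fin_num_measure//.
  by rewrite -leeBlDl// -EFinB.
have := data_law_neyman_pearson hip heps s0 a01 Kne mB PB.
rewrite leNgt => /negP; apply; apply: lt_le_trans hx; rewrite lte_fin.
apply: stdnormal_cdf_incr; rewrite ltrD2r ltr_pM2r ?invr_gt0// Kfl normrZ.
by rewrite gtr_pMl ?normr_gt0// ger0_norm; lra.
Qed.

Theorem theorem3p1 (R : realType) (V : lmodType R) (Y : completeNormedModType R)
    (ip : {dot Y for (@idfun R)}) (hip : is_hilbert_product ip)
    (K : {linear V -> Y}) (L : {scalar V})
    (dT : measure_display) (T : measurableType dT) (P : probability T R)
    (eps : Y -> {RV P >-> R}) (heps : standard_gaussian_noise eps)
    (sigma : R) (hsigma : 0 < sigma)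
    (alpha : R) (halpha0 : 0 < alpha) (halpha1 : alpha < 1)
    (F G : set V) (hF : convex_set F) (hG : convex_set G) (hGF : G `<=` F)
    (delta : R) (hdelta : 0 < delta)
    (domega : R) (hdomega : superdifferential K L F G delta domega)
    (fs gs : V) (hfs : F fs) (hgs : G gs)
    (hmod : (L gs - L fs)%:E = modulus K L F G delta)
    (hdist : `|K (fs - gs)| = delta) :
  let Pf := data_law ip K sigma eps in
  let cs := chat K L ip Pf F alpha sigma delta domega fs gs in
  let beta := stdnormal_cdf (delta / sigma - stdnormal_quantile (1 - alpha)) in
  [/\ max_bias Pf L F (Lhat K L ip delta domega fs gs) \is a fin_num,
      one_sided_CI Pf L F alpha cs /\
      (forall c : sample_space Y -> R, one_sided_CI Pf L F alpha c ->
         (worst_excess_quantile Pf L G beta cs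
            <= worst_excess_quantile Pf L G beta c)%E),
      coverage Pf L cs fs = ereal_inf [set coverage Pf L cs f | f in F] /\
      (0 < domega -> coverage Pf L cs fs = (1 - alpha)%:E),
      (forall p : R, 0 < p -> p < 1 -> forall g : V, G g ->
         excess_quantile Pf L cs p g <= excess_quantile Pf L cs p gs)
    & worst_excess_quantile Pf L G beta cs = modulus K L F G delta].
Proof.
move=> Pf cs beta; set z := stdnormal_quantile (1 - alpha).
have hdist' : `|K (gs - fs)| = delta by rewrite -hdist -opprB linearN normrN.
have d0 : 0 <= domega.
  exact: (superdifferential_ge0 hdelta hdomega hfs hgs hmod hdist).
have s0 : 0 <= domega * sigma by rewrite mulr_ge0// ltW.
pose bias := estimator_bias ip K L delta domega fs gs.
(* [b] turns out to be the maximal bias, reached at [fs]; the bias at [gs] is [- b], the least over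
   [G]. *)
pose om := L gs - L fs; pose b := (om - domega * delta) / 2.
have bias_fs : bias fs = b by exact: (estimator_bias_left hip).
have bias_gs : bias gs = - b.
  by rewrite /bias (estimator_bias_right hip)// mulNr.
have bias_le f : F f -> bias f <= b.
  move=> Ff; rewrite -bias_fs -subr_le0 estimator_biasB.
  have := modulus_tangent_left hip hF hdelta hdomega hfs hgs hmod hdist Ff.
  by lra.
have bias_ge g : G g -> - b <= bias g.
  move=> Gg; rewrite -bias_gs -subr_ge0 estimator_biasB.
  have := modulus_tangent_right hip hG hdelta hdomega hfs hgs hmod hdist Gg.
  by lra.
have mbias : max_bias Pf L F (Lhat K L ip delta domega fs gs) = b%:E.
  apply/eqP; rewrite eq_le; apply/andP; split.
    apply: ge_ereal_sup => _ [f Ff <-].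
    by rewrite (expectation_Lhat ip K L heps)// lee_fin bias_le.
  apply: ereal_sup_ubound; exists fs => //.
  by rewrite (expectation_Lhat ip K L heps)// -/bias bias_fs.
pose B := b + z * sigma * domega.
have csE y : cs y = Lhat K L ip delta domega fs gs y - B.
  by rewrite /cs /chat mbias /= /B -/z opprD addrA.
have mcs : measurable_fun setT cs.
  rewrite (_ : cs = fun y => Lhat K L ip delta domega fs gs y - B).
    by apply: measurable_funB => //; exact: measurable_Lhat.
  by apply/funext.
have zE : stdnormal_cdf z = 1 - alpha by rewrite stdnormal_quantileK//; lra.
have covE f : coverage Pf L cs f =
    if domega * sigma == 0 then (bias f - b <= z * sigma * domega)%R%:R%:E
    else (stdnormal_cdf ((z * sigma * domega - (bias f - b)) / (domega * sigma)))%:E.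
  rewrite /coverage; under eq_set do rewrite csE.
  rewrite (estimator_bias_prob ip L heps sigma domega hdelta hdist').
  rewrite -stdnormal_prob_location_scale//; congr (normal_prob 0 1 _).
  apply/funext => t; rewrite /mkset /B -/(bias f); congr is_true.
  by rewrite -subr_ge0 -[RHS]subr_ge0; congr (0 <= _); ring.
have cov_min f : F f -> (coverage Pf L cs fs <= coverage Pf L cs f)%E.
  move=> Ff; have bf := bias_le f Ff; rewrite !covE bias_fs subrr subr0.
  have [s00|sn0] := eqVneq (domega * sigma) 0.
    have zsd : z * sigma * domega = 0 by rewrite -mulrA (mulrC sigma) s00 mulr0.
    by rewrite zsd lexx (_ : bias f - b <= 0)// subr_le0.
  rewrite lee_fin stdnormal_cdf_le ler_wpM2r ?invr_ge0//; lra.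
have cov_fs : 0 < domega -> coverage Pf L cs fs = (1 - alpha)%:E.
  move=> dgt0; rewrite covE bias_fs subrr subr0 gt_eqF ?mulr_gt0//.
  rewrite (_ : z * sigma * domega / _ = z) ?zE//.
  by field; rewrite !gt_eqF.
(* When [domega = 0] the endpoint is deterministic and the coverage at [fs] is 1. *)
have cov_ge : ((1 - alpha)%:E <= coverage Pf L cs fs)%E.
  have [d00|dn0] := eqVneq domega 0; last first.
    by rewrite cov_fs// lt_neqAle eq_sym dn0.
  by rewrite covE d00 mul0r eqxx mulr0 bias_fs subrr lexx lee_fin gerBl ltW.
have exE g p : 0 < p < 1 -> excess_quantile Pf L cs p g =
    B - bias g + domega * sigma * stdnormal_quantile p.
  move=> /stdnormal_cdf_surj[q <-]; rewrite stdnormal_cdfK.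
  apply: quantile_location_scale => //.
    by rewrite stdnormal_cdf_gt0 stdnormal_cdf_lt1.
  move=> x; under eq_set do rewrite csE.
  exact: (estimator_excess_prob ip L heps sigma domega hdelta hdist').
have ex_max p g : 0 < p < 1 -> G g ->
    excess_quantile Pf L cs p g <= excess_quantile Pf L cs p gs.
  move=> p01 Gg; have := bias_ge g Gg; rewrite !exE// bias_gs; lra.
have beta01 : 0 < beta < 1 by rewrite stdnormal_cdf_gt0 stdnormal_cdf_lt1.
(* The choice of [beta] makes the terms in [z] cancel, leaving [2 * b + domega * delta = om]. *)
have ex_gs : excess_quantile Pf L cs beta gs = om.
  rewrite exE// stdnormal_cdfK bias_gs -/z /B /b.
  by field; rewrite gt_eqF.
have worst : worst_excess_quantile Pf L G beta cs = om%:E.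
  apply/eqP; rewrite eq_le; apply/andP; split.
    apply: ge_ereal_sup => _ [g Gg <-].
    by rewrite lee_fin -ex_gs ex_max.
  by apply: ereal_sup_ubound; exists gs => //; rewrite ex_gs.
split.
- by rewrite mbias.
- split.
    split=> //; apply: le_ereal_inf_tmp => _ [f Ff <-].
    exact: le_trans cov_ge (cov_min f Ff).
  move=> c hc; rewrite worst.
  apply: (@le_trans _ _ (excess_quantile Pf L c beta gs)%:E); last first.
    by apply: ereal_sup_ubound; exists gs.
  rewrite lee_fin /beta -hdist'.
  apply: (excess_quantile_lower_bound hip heps hsigma _ hF) => //.
  + by rewrite halpha0.
  + exact: hGF.
  + rewrite eq_sym -subr_eq0 -linearB -normr_eq0 hdist' gt_eqF//.
  (* As [G] lies in [F], the pair [(gs, gs)] is admissible in the modulus, which is therefore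
     nonnegative. *)
  + have dd : `|K (gs - gs)| <= delta by rewrite subrr linear0 normr0 ltW.
    have : ((L gs - L gs)%:E <= modulus K L F G delta)%E.
      by apply: modulus_ub => //; exact: hGF.
    by rewrite -hmod lee_fin subrr subr_ge0.
- split; last exact: cov_fs.
  apply/eqP; rewrite eq_le; apply/andP; split.
    by apply: le_ereal_inf_tmp => _ [f Ff <-]; exact: cov_min.
  by apply: ereal_inf_lbound; exists fs.
- by move=> p p0 p1 g Gg; apply: ex_max => //; rewrite p0.
- by rewrite worst hmod.
Qed.
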